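(* Deciding whether a given graph admits proper Laplacian fractional revival, and finding the earliest time at which it occurs, can be done in polynomial time (in the number of vertices).
   Context: For a graph $X$ with adjacency matrix $A$ and diagonal degree matrix $D$, the Laplacian is $L=D-A$ and the transition matrix is $U(t)=\exp(itL)$. $X$ admits Laplacian fractional revival from vertex $a$ to vertex $b\neq a$ at time $\tau$ if $U(\tau)e_a=\alpha e_a+\beta e_b$ for some complex $\alpha,\beta$; it is proper if $\beta\neq0$. *)

(* Defs.v *)
From HB Require Import structures.
From mathcomp Require Import all_boot all_order all_algebra.
From mathcomp Require Import all_classical all_reals all_analysis.
From mathcomp Require Import complex.

Set Implicit Arguments.
Unset Strict Implicit.
Unset Printing Implicit Defensive.

Import Order.TTheory GRing.Theory Num.Theory.
Import numFieldNormedType.Exports.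

(* A simple graph on n vertices is a symmetric irreflexive e : rel 'I_n. *)

Section LaplacianRevival.
Local Open Scope ring_scope.
Local Open Scope complex_scope.

Variable R : realType.

(* The limit is taken entry by entry; R[i]^o is R[i] with its norm topology. *)
Definition mexp n (M : 'M[R[i]]_n) : 'M[R[i]]_n :=
  \matrix_(i, j)
    limn (series (fun k => (k`!%:R^-1 * (M ^+ k) i j : R[i]^o))).

Variables (n : nat) (e : rel 'I_n).

Definition adjacency : 'M[R[i]]_n := \matrix_(i, j) (e i j)%:R.

Definition degree_matrix : 'M[R[i]]_n :=
  diag_mx (\row_i #|[set j | e i j]|%:R).

Definition laplacian : 'M[R[i]]_n := degree_matrix - adjacency.

Definition transition (t : R) : 'M[R[i]]_n := mexp ((0 +i* t) *: laplacian).

Definition vertex_vec (a : 'I_n) : 'cV[R[i]]_n := delta_mx a 0.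

Definition proper_revival (a b : 'I_n) (tau : R) : Prop :=
  a != b /\
  exists alpha beta : R[i], beta != 0 /\
    transition tau *m vertex_vec a =
      alpha *: vertex_vec a + beta *: vertex_vec b.

Definition revival_at (tau : R) : Prop :=
  exists a b : 'I_n, proper_revival a b tau.

Definition admits_revival : Prop := exists tau : R, revival_at tau.

Definition earliest_revival (tau : R) : Prop :=
  [/\ 0 <= tau, revival_at tau &
      forall s : R, 0 <= s -> revival_at s -> tau <= s].

(* Contents of the output tape:
   - 0        no proper revival;
   - 1, p, q  proper revival, with earliest time 2 pi p / q;
   - 2        proper revival, but no earliest time.  The last case is not
     vacuous: on K_2 every t in ]0, pi[ is a time of proper revival. *)
Definition revival_answer (out : seq nat) : Prop :=
  [\/ out = [:: 0%N] /\ ~ admits_revival,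
      exists p q : nat,
        [/\ out = [:: 1%N; p; q], (0 < q)%N &
            earliest_revival (2 * pi * p%:R / q%:R)] |
      [/\ out = [:: 2%N], admits_revival &
          ~ exists tau : R, earliest_revival tau]].

End LaplacianRevival.

(* Random access machine with the logarithmic cost criterion (Cook & Reckhow;
   Aho, Hopcroft & Ullman).  Registers hold arbitrary natural numbers; the
   input tape is read-only and one-way, the output tape write-only. *)

Inductive ram_instr : Type :=
| Const of nat & nat          (* r[x] := k *)
| Add of nat & nat & nat      (* r[x] := r[y] + r[z] *)
| Sub of nat & nat & nat      (* r[x] := r[y] - r[z], truncated at 0 *)
| Mul of nat & nat & nat      (* r[x] := r[y] * r[z] *)
| LoadAt of nat & nat           (* r[x] := r[r[y]] *)
| StoreAt of nat & nat          (* r[r[x]] := r[y] *)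
| Jump of nat                 (* goto l *)
| JumpZero of nat & nat       (* if r[x] = 0 then goto l *)
| Read of nat                 (* r[x] := next input number, 0 if exhausted *)
| Write of nat.               (* append r[x] to the output *)

Definition ram_program := seq ram_instr.

Record ram_state := RamState {
  pc : nat;
  reg : nat -> nat;
  inp : seq nat;
  out : seq nat
}.

Definition ram_init (input : seq nat) : ram_state :=
  RamState 0 (fun=> 0) input [::].

Definition set_reg (s : ram_state) (x v : nat) : ram_state :=
  RamState (pc s).+1 [eta reg s with x |-> v] (inp s) (out s).

Definition jump (s : ram_state) (l : nat) : ram_state :=
  RamState l (reg s) (inp s) (out s).

Definition exec (i : ram_instr) (s : ram_state) : ram_state :=
  let r := reg s in
  match i with
  | Const x k => set_reg s x k
  | Add x y z => set_reg s x (r y + r z)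
  | Sub x y z => set_reg s x (r y - r z)
  | Mul x y z => set_reg s x (r y * r z)
  | LoadAt x y => set_reg s x (r (r y))
  | StoreAt x y => set_reg s (r x) (r y)
  | Jump l => jump s l
  | JumpZero x l => jump s (if r x == 0 then l else (pc s).+1)
  | Read x =>
      RamState (pc s).+1 [eta r with x |-> head 0 (inp s)]
        (behead (inp s)) (out s)
  | Write x => RamState (pc s).+1 r (inp s) (rcons (out s) (r x))
  end.

(* Number of binary digits, with bitlen 0 = 1. *)
Definition bitlen (m : nat) : nat := (trunc_log 2 m).+1.

(* Total length of the addresses and of the numbers an instruction handles. *)
Definition instr_cost (i : ram_instr) (s : ram_state) : nat :=
  let r := reg s in
  match i with
  | Const x k => bitlen x + bitlen k
  | Add x y z | Sub x y z | Mul x y z =>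
      bitlen x + bitlen y + bitlen z + bitlen (r y) + bitlen (r z)
  | LoadAt x y => bitlen x + bitlen y + bitlen (r y) + bitlen (r (r y))
  | StoreAt x y => bitlen x + bitlen y + bitlen (r x) + bitlen (r y)
  | Jump l => bitlen l
  | JumpZero x l => bitlen x + bitlen (r x) + bitlen l
  | Read x => bitlen x + bitlen (head 0 (inp s))
  | Write x => bitlen x + bitlen (r x)
  end.

(* The machine halts when the program counter leaves the program. *)
Definition halted (P : ram_program) (s : ram_state) : bool := size P <= pc s.

Definition step (P : ram_program) (s : ram_state) : ram_state :=
  if onth P (pc s) is Some i then exec i s else s.

Definition step_cost (P : ram_program) (s : ram_state) : nat :=
  if onth P (pc s) is Some i then instr_cost i s else 0.

Definition run (P : ram_program) (input : seq nat) (t : nat) : ram_state :=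
  iter t (step P) (ram_init input).

Definition outputs_in_time (P : ram_program) (input output : seq nat)
    (T : nat) : Prop :=
  exists t : nat,
    [/\ halted P (run P input t), out (run P input t) = output &
        \sum_(s < t) step_cost P (run P input s) <= T].

(* n, followed by the adjacency matrix in row-major order. *)
Definition graph_input (n : nat) (e : rel 'I_n) : seq nat :=
  n :: [seq nat_of_bool (e i j) | i <- enum 'I_n, j <- enum 'I_n].

(* Main.v *)
Require Import Defs.
From mathcomp Require Import all_boot all_order all_algebra.
From mathcomp Require Import all_classical all_reals all_analysis.
From mathcomp Require Import complex spectral algC algnum ring lra zify.

(* Write u = e_a + e_b and w = e_a - e_b.  Since U(t) is symmetric, unitary and
   fixes the all-ones vector, proper revival from a to b at time t means that
   U(t) fixes u and multiplies w by some g != 1.  If L u = 0 then {a, b} is a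
   component K_2 and revival occurs at all small t > 0.  Otherwise 2 pi / t is
   commensurable with a nonzero eigenvalue in the support of u, and since the
   sum of the eigenvalues supporting a rational vector is rational, all those
   supporting u and w are integers; they lie in [0, 2 n].  With h the least
   positive integer such that t h is in 2 pi Z, the support of u lies in h Z,
   that of w in r + h Z with 0 < r < h, and conversely such h and r give
   revival at 2 pi / h.  These inclusions are the vanishing of the product of
   the (L - th) applied to u or w, th ranging over a residue class, an integer
   computation; the largest successful h gives the earliest time.  The bound
   on h exceeds 2 n, so that K_2 is betrayed by a success with h > 2 n + 2.

   That computation needs no multiplication, so the numbers grow by at most
   one digit per step and the logarithmic cost is at most quadratic in the
   number of steps. *)

Set Implicit Arguments.
Unset Strict Implicit.
Unset Printing Implicit Defensive.

Import Order.TTheory GRing.Theory Num.Theory.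
Import numFieldNormedType.Exports.

(** * The transition matrix *)

(** The sum over a support takes the place of any study of conjugate eigenvalues. The eigenvalues
    supporting u are all integer multiples of the single number 2 pi / t; they are nonnegative and,
    outside the K_2 case, one is positive, so a rational sum makes 2 pi / t rational. Those
    supporting w agree only modulo such multiples, but the rational sum of k of them determines k
    times the common offset, with k nonzero. A rational eigenvalue of an integer matrix is an
    integer.

    A revival at s > 0 gives s h = 2 pi m with m at least 1, hence s is at least 2 pi / h: this is
    why the largest h matters. Once h reaches the number of integers th tested, a residue class
    holds at most one of them, so success pins u to the eigenvalue 0 and w to r, and every small t >
    0 works.

    On the machine side the obstacle is to reason about jumps. A structured language with counted
    loops removes them: its commands are total functions, and its running time is polynomial for a
    syntactic reason, every loop being driven by one of two registers fixed at the start. *)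

Section ComplexExponential.
Local Open Scope ring_scope.
Local Open Scope complex_scope.
Local Open Scope classical_set_scope.
Variable R : realType.
Implicit Types (t : R) (k n : nat).

Lemma cvg_real_complex (u : nat -> R) (l : R) :
  u @ \oo --> l -> (fun k => (u k)%:C : R[i]^o) @ \oo --> (l%:C : R[i]^o).
Proof.
move=> ul; apply/cvgrPdist_lt => eps eps0.
have epsE : eps = (complex.Re eps)%:C.
  by move: eps0; rewrite ltcE /= => /andP[/eqP]; case: eps => a b /= ->.
have e0 : 0 < complex.Re eps by move: eps0; rewrite ltcE => /andP[].
move/cvgrPdist_lt: ul => /(_ _ e0); apply: filterS => k ltk.
rewrite -raddfB /= epsE normc_def /= expr0n addr0 sqrtr_sqr.
by rewrite ltcR.
Qed.

Lemma cvg_complex (u v : nat -> R) (a b : R) :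
  u @ \oo --> a -> v @ \oo --> b ->
  (fun k => (u k +i* v k) : R[i]^o) @ \oo --> ((a +i* b) : R[i]^o).
Proof.
move=> ua vb.
have E (x y : R) : (x +i* y) = x%:C + 'i * y%:C by simpc.
under eq_fun do rewrite E.
rewrite E; apply: cvgD; first exact: cvg_real_complex.
by apply: cvgMr; exact: cvg_real_complex.
Qed.

Definition cis t : R[i] := cos t +i* sin t.

(** The two components have the shape of [cos_coeff] and [sin_coeff], so that partial sums of the
    exponential series match theirs term by term. *)
Lemma iexpE k : ('i : R[i]) ^+ k =
  ((~~ odd k)%:R * (-1) ^+ k./2) +i* ((odd k)%:R * (-1) ^+ k.-1./2).
Proof.
elim: k => [|k IH]; first by rewrite expr0 /= mul1r mul0r.
rewrite exprS IH /=; case: (boolP (odd k)) => ok /=; simpc.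
  case: k ok {IH} => //= k ok.
  by rewrite exprS mulN1r.
by [].
Qed.

Lemma cvg_cis t :
  series (fun k => (k`!%:R^-1 * (0 +i* t) ^+ k : R[i]^o)) @ \oo --> (cis t : R[i]^o).
Proof.
have E : series (fun k => (k`!%:R^-1 * (0 +i* t) ^+ k : R[i]^o)) =
   (fun k => (series (cos_coeff t) k +i* series (sin_coeff t) k) : R[i]^o).
  apply/funext => k; rewrite /series /=; elim: k => [|k IH].
    by rewrite !big_geq.
  rewrite !big_nat_recr //= IH.
  have -> : (0 +i* t) = 'i * t%:C by simpc.
  rewrite exprMn iexpE -rmorphXn /= -(rmorph_nat (real_complex R)) -fmorphV /=.
  rewrite /cos_coeff /sin_coeff /=; simpc.
  by congr (_ +i* _); congr (_ + _); rewrite mulrC.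
rewrite E /cis unlock; apply: cvg_complex.
  exact: is_cvg_series_cos_coeff.
rewrite sin.unlock; exact: is_cvg_series_sin_coeff.
Qed.

Lemma hausdorff_complex : hausdorff_space R[i]^o.
Proof. exact: norm_hausdorff. Qed.

End ComplexExponential.

(** * Exponential of a diagonalised matrix, and phases on the unit circle *)

Section SpectralExponential.
Local Open Scope ring_scope.
Local Open Scope complex_scope.
Local Open Scope classical_set_scope.
Local Open Scope sesquilinear_scope.
Variable R : realType.

Lemma mexp_tr n (M : 'M[R[i]]_n) : M^T = M -> (mexp M)^T = mexp M.
Proof.
move=> Msym.
have powT k : (M ^+ k)^T = M ^+ k.
  elim: k => [|k IH]; first by rewrite expr0 trmx1.
  by rewrite exprS -mulmxE trmx_mul IH Msym mulmxE -exprSr exprS.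
apply/matrixP => i j; rewrite !mxE.
suff -> : (fun k => k`!%:R^-1 * (M ^+ k) j i : R[i]^o) =
          (fun k => k`!%:R^-1 * (M ^+ k) i j) by [].
by apply/funext => k; rewrite -[in RHS]powT mxE.
Qed.

Lemma mexp_diag n (Q : 'M[R[i]]_n) (y : 'I_n -> R) : Q \in unitmx ->
  mexp (invmx Q *m diag_mx (\row_l (0 +i* y l)) *m Q) =
  invmx Q *m diag_mx (\row_l cis (y l)) *m Q.
Proof.
move=> Qu; set M := (X in mexp X).
have powM k : M ^+ k = invmx Q *m diag_mx (\row_l (0 +i* y l) ^+ k) *m Q.
  elim: k => [|k IH].
    rewrite expr0 [X in diag_mx X](_ : _ = const_mx 1).
      by rewrite diag_const_mx mulmx1 mulVmx.
    by apply/rowP => l; rewrite !mxE expr0.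
  rewrite exprSr IH -mulmxE /M !mulmxA mulmxK //.
  rewrite -(mulmxA (invmx Q)) mulmx_diag; congr (_ *m diag_mx _ *m _).
  by apply/rowP => l; rewrite !mxE exprSr.
have entE (z : 'I_n -> R[i]) i j :
    (invmx Q *m diag_mx (\row_l z l) *m Q) i j =
    \sum_l (invmx Q i l * Q l j) * z l.
  rewrite mul_mx_diag mxE; apply: eq_bigr => l _; rewrite !mxE; ring.
apply/matrixP => i j; rewrite [in LHS]mxE entE.
have -> : series (fun k => (k`!%:R^-1 * (M ^+ k) i j : R[i]^o)) =
  (fun m => \sum_l (invmx Q i l * Q l j) *
     series (fun k => (k`!%:R^-1 * (0 +i* y l) ^+ k : R[i]^o)) m : R[i]^o).
  apply/funext => m; rewrite /series /=.
  transitivity (\sum_(0 <= k < m) \sum_l (invmx Q i l * Q l j) *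
      (k`!%:R^-1 * (0 +i* y l) ^+ k)).
    apply: eq_bigr => k _; rewrite powM entE mulr_sumr.
    by apply: eq_bigr => l _; ring.
  by rewrite exchange_big; apply: eq_bigr => l _; rewrite mulr_sumr.
apply: (@cvg_lim R[i]^o); first exact: hausdorff_complex.
apply: (@cvg_big R[i]^o 'I_n +%R 0 xpredT (@add_continuous R[i]^o)) => l _.
apply: cvgMr; exact: cvg_cis.
Qed.

Lemma cis0 : cis 0 = 1 :> R[i].
Proof. by rewrite /cis cos0 sin0. Qed.

Lemma cisD (x y : R) : cis (x + y) = cis x * cis y.
Proof. by rewrite /cis cosD sinD; simpc; rewrite [X in _ +i* X]addrC. Qed.

Lemma cisN (x : R) : cis (- x) = Num.conj (cis x).
Proof. by rewrite /cis cosN sinN. Qed.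

Lemma cis_conj (x : R) : cis x * Num.conj (cis x) = 1.
Proof. by rewrite -cisN -cisD subrr cis0. Qed.

Lemma cis_int (m : int) : cis (2 * pi * m%:~R : R) = 1.
Proof.
have nat_case (k : nat) : cis (2 * pi * k%:R : R) = 1.
  elim: k => [|k IH]; first by rewrite mulr0 cis0.
  rewrite -[k.+1%:R]natr1 mulrDr cisD IH mul1r mulr1 /cis mulr_natl cos2pi sin2pi //.
case: m => p; first by rewrite -pmulrn nat_case.
by rewrite NegzE mulrNz mulrN cisN -pmulrn nat_case rmorph1.
Qed.

Lemma cis_eq1 (x : R) : cis x = 1 -> exists m : int, x = 2 * pi * m%:~R.
Proof.
move=> x1; have pi0 := pi_gt0 R.
pose m := Num.floor (x / (2 * pi)); exists m.
pose y := x - 2 * pi * m%:~R.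
have y1 : cis y = 1 by rewrite /y cisD x1 mul1r cisN cis_int rmorph1.
have y0 : 0 <= y.
  rewrite subr_ge0 mulrC -ler_pdivlMr ?mulr_gt0 //; by case/andP: (floor_itv (x / (2 * pi))).
have yu : y < 2 * pi.
  rewrite ltrBlDr -[X in X + _]mulr1 -mulrDr mulrC -ltr_pdivrMr ?mulr_gt0 //.
  by rewrite addrC -[1](mulr1z 1) -intrD; exact: floorD1_gt.
have cy : cos y = 1 by move: y1 => /(congr1 (@complex.Re R)).
suff : y = 0 by move=> /eqP; rewrite subr_eq0 => /eqP.
apply/eqP; rewrite eq_le y0 andbT leNgt; apply/negP => ygt0.
(* Half the angle lies in ]0, pi[, where the sine is positive; this contradicts cos y = 1 - 2 sin^2
   (y / 2) = 1. *)
have : sin (y / 2) != 0.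
  by rewrite gt_eqF // sin_gt0_pi // divr_gt0 //= ltr_pdivrMr // mulrC.
have : cos y = 1 - sin (y / 2) ^+ 2 *+ 2.
  by rewrite {1}[y](splitr y) -mulr2n cos_mulr2n cos2sin2 mulrnBl; ring.
rewrite cy => /eqP; rewrite -subr_eq0 opprB addrC subrK mulrn_eq0 /= sqrf_eq0.
by move=> /eqP ->; rewrite eqxx.
Qed.

End SpectralExponential.

(** * Spectral decomposition of the Laplacian *)

Section LaplacianSpectrum.
Local Open Scope ring_scope.
Local Open Scope complex_scope.
Local Open Scope sesquilinear_scope.
Variable R : realType.
Variables (n : nat) (e : rel 'I_n).
Hypotheses (e_sym : symmetric e) (e_irr : irreflexive e).

Local Notation L := (laplacian R e).
Local Notation U := (@transition R n e).

Definition deg (i : 'I_n) : nat := #|[set j | e i j]|.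

(** Over [int], since the program computes with it and since rationality and integrality of the
    spectrum come from its integer entries. *)
Definition intlap : 'M[int]_n :=
  \matrix_(i, j) ((deg i)%:Z *+ (i == j) - (e i j)%:Z).

Lemma intlapE : L = map_mx intr intlap.
Proof.
apply/matrixP => i j; rewrite !mxE rmorphB rmorphMn /=.
by congr (_ - _); rewrite -!pmulrn.
Qed.

Lemma intlap_sym : intlap^T = intlap.
Proof.
apply/matrixP => i j; rewrite !mxE e_sym eq_sym.
by case: eqVneq => [->|].
Qed.

Lemma laplacian_tr : L^T = L.
Proof. by rewrite intlapE map_trmx intlap_sym. Qed.

Lemma laplacian_diag : exists (Q : 'M[R[i]]_n) (lam : 'I_n -> R),
  Q \is unitarymx /\ L = invmx Q *m diag_mx (\row_l (lam l)%:C) *m Q.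
Proof.
have Lreal : L \is a mxOver Num.real.
  by apply/mxOverP => i j; rewrite intlapE mxE realz.
have Lherm : L \is hermsymmx.
  apply: realsym_hermsym => //; apply/is_hermitianmxP.
  rewrite expr0 scale1r; apply/matrixP => i j.
  by rewrite -[in LHS]laplacian_tr !mxE.
have /orthomx_spectralP LE := hermitian_normalmx Lherm.
have /mxOverP dreal := hermitian_spectral_diag_real Lherm.
exists (spectralmx L), (fun l => complex.Re (spectral_diag L 0 l)).
split; first exact: spectral_unitarymx.
rewrite {1}LE; congr (_ *m diag_mx _ *m _); apply/rowP => l.
by rewrite mxE RRe_real.
Qed.

End LaplacianSpectrum.

(** * Proper revival as an eigenvector condition *)

Section Diagonalised.
Local Open Scope ring_scope.
Local Open Scope complex_scope.
Local Open Scope sesquilinear_scope.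
Variable R : realType.
Variables (n : nat) (e : rel 'I_n).
Hypotheses (e_sym : symmetric e) (e_irr : irreflexive e).
Local Notation L := (laplacian R e).
Local Notation U := (@transition R n e).

Variables (Q : 'M[R[i]]_n) (lam : 'I_n -> R).
Hypothesis Q_unitary : Q \is unitarymx.
Hypothesis LE : L = invmx Q *m diag_mx (\row_l (lam l)%:C) *m Q.

Let Q_unit : Q \in unitmx. Proof. exact: unitarymx_unit. Qed.

Lemma transitionE t :
  U t = invmx Q *m diag_mx (\row_l cis (t * lam l)) *m Q.
Proof.
rewrite -(mexp_diag (fun l => t * lam l) Q_unit) /transition.
suff -> : (0 +i* t) *: L = invmx Q *m diag_mx (\row_l (0 +i* (t * lam l))) *m Q by [].
rewrite LE scalemxAl scalemxAr; congr (_ *m _ *m _).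
by apply/matrixP => i j; rewrite !mxE mulrnAr; simpc.
Qed.

Lemma coord_diag (z : 'I_n -> R[i]) (v : 'cV[R[i]]_n) l :
  (Q *m (invmx Q *m diag_mx (\row_l z l) *m Q *m v)) l 0 = z l * (Q *m v) l 0.
Proof. by rewrite !mulmxA mulmxV // mul1mx -mulmxA mul_diag_mx !mxE. Qed.

Lemma coord_inj (v w : 'cV[R[i]]_n) :
  (forall l, (Q *m v) l 0 = (Q *m w) l 0) -> v = w.
Proof.
move=> vw; apply: (can_inj (mulKmx Q_unit)).
by apply/colP => l.
Qed.

(** Only coordinates in the support of [v] are constrained: through this equivalence, statements
    about U(t) and L become statements about the eigenvalues in a support. *)
Lemma diag_eigenP (z : 'I_n -> R[i]) (v : 'cV[R[i]]_n) g :
  invmx Q *m diag_mx (\row_l z l) *m Q *m v = g *: v <->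
  (forall l, (Q *m v) l 0 != 0 -> z l = g).
Proof.
split=> [E l vl|zg].
  apply: (mulIf vl); rewrite -coord_diag E.
  by rewrite -scalemxAr mxE.
apply: coord_inj => l; rewrite coord_diag -scalemxAr [RHS]mxE.
by have [->|/zg ->] := eqVneq ((Q *m v) l 0) 0; rewrite ?mulr0.
Qed.

Lemma transition_eigenP t (v : 'cV[R[i]]_n) g :
  U t *m v = g *: v <-> (forall l, (Q *m v) l 0 != 0 -> cis (t * lam l) = g).
Proof. by rewrite transitionE; exact: diag_eigenP. Qed.

Lemma laplacian_eigenP (v : 'cV[R[i]]_n) g :
  L *m v = g *: v <-> (forall l, (Q *m v) l 0 != 0 -> (lam l)%:C = g).
Proof. by rewrite {1}LE; exact: diag_eigenP. Qed.

Lemma transition_tr t : (U t)^T = U t.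
Proof.
apply: mexp_tr; rewrite linearZ /=; congr (_ *: _).
exact: laplacian_tr.
Qed.

Lemma transition_unitary t : (U t)^t* *m U t = 1%:M.
Proof.
rewrite transitionE (invmx_unitary Q_unitary).
rewrite !trmx_mul !map_mxM /= trmxCK tr_diag_mx map_diag_mx.
rewrite !mulmxA mulmxtVK //.
rewrite -(mulmxA _ (diag_mx _) (diag_mx _)) mulmx_diag.
rewrite [X in diag_mx X](_ : _ = const_mx 1).
  rewrite diag_const_mx mulmx1 -(invmx_unitary Q_unitary) mulVmx //.
by apply/rowP => l; rewrite !mxE mulrC cis_conj.
Qed.

Lemma laplacian_ones : L *m (const_mx 1 : 'cV_n) = 0.
Proof.
apply/colP => i; rewrite !mxE.
under eq_bigr do rewrite intlapE !mxE mulr1 rmorphB rmorphMn /=.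
rewrite sumrB (bigD1 i) //= eqxx mulr1n big1 ?addr0 => [|j /negbTE ji]; last first.
  by rewrite eq_sym ji mulr0n.
apply/eqP; rewrite subr_eq0; apply/eqP.
rewrite /deg -sum1_card -pmulrn natr_sum big_mkcond /=.
by apply: eq_bigr => j _; rewrite inE -pmulrn; case: (e i j).
Qed.

Lemma transition_ones t : U t *m (const_mx 1 : 'cV_n) = const_mx 1.
Proof.
rewrite -[RHS]scale1r; apply/transition_eigenP => l vl.
suff -> : lam l = 0 by rewrite mulr0 cis0.
have /laplacian_eigenP/(_ l vl) : L *m (const_mx 1 : 'cV_n) = 0 *: const_mx 1.
  by rewrite scale0r laplacian_ones.
by case.
Qed.

Lemma transition_col_dot t j k :
  \sum_i Num.conj (U t i j) * U t i k = (j == k)%:R.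
Proof.
have /matrixP/(_ j k) := transition_unitary t; rewrite !mxE => <-.
by apply: eq_bigr => i _; rewrite !mxE.
Qed.

Lemma transition_col_sum t j : \sum_i U t i j = 1.
Proof.
have /matrixP/(_ j 0) := transition_ones t; rewrite [RHS]mxE [LHS]mxE => <-.
apply: eq_bigr => i _; rewrite [const_mx 1 _ _]mxE mulr1.
by rewrite -[in LHS]transition_tr mxE.
Qed.

Lemma sum_two (V : zmodType) (F : 'I_n -> V) a b : a != b ->
  (forall i, i != a -> i != b -> F i = 0) -> \sum_i F i = F a + F b.
Proof.
move=> ab F0; rewrite (bigD1 a) //= (bigD1 b) 1?eq_sym //= big1 ?addr0 //.
by move=> i /andP[ia ib]; exact: F0.
Qed.

(** Column a of U(t) holds only alpha and beta. Their sum is 1 by the all-ones vector and their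
    squared moduli sum to 1 by unitarity, so the cross terms cancel. Orthogonality of columns a and
    b then forces the entry (b, b) to be alpha, and column b has no norm left for other entries. On
    e_a, e_b the matrix is thus symmetric 2 by 2, with eigenvalue 1 on the sum and alpha - beta on
    the difference; the latter is 1 only if beta = 0. *)
Lemma proper_revivalP a b t : proper_revival e a b t <->
  [/\ a != b,
      U t *m (vertex_vec R a + vertex_vec R b) = vertex_vec R a + vertex_vec R b
    & exists2 g, g != 1 &
      U t *m (vertex_vec R a - vertex_vec R b) =
        g *: (vertex_vec R a - vertex_vec R b)].
Proof.
split=> [[ab [al [be [be0 Ua]]]] | [ab Us [g g1 Ud]]]; last first.
  split=> //; exists ((1 + g) / 2), ((1 - g) / 2); split.
    by rewrite mulf_neq0 ?invr_eq0 ?pnatr_eq0 // subr_eq0 eq_sym.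
  have two0 : (2 : R[i]) != 0 by rewrite pnatr_eq0.
  have aE : vertex_vec R a = 2^-1 *: ((vertex_vec R a + vertex_vec R b) +
      (vertex_vec R a - vertex_vec R b)).
    by apply/colP => i; rewrite !mxE; field.
  rewrite {1}aE -scalemxAr mulmxDr Us Ud; apply/colP => i; rewrite !mxE.
  by field.
have Uia i : U t i a = al * (i == a)%:R + be * (i == b)%:R.
  by move: Ua; rewrite -colE => /colP/(_ i); rewrite !mxE !andbT.
have Uaa : U t a a = al by rewrite Uia eqxx (negbTE ab) mulr1 mulr0 addr0.
have Uba : U t b a = be by rewrite Uia eqxx eq_sym (negbTE ab) mulr1 mulr0 add0r.
have Uab : U t a b = be by rewrite -transition_tr mxE.
have Uia0 i : i != a -> i != b -> U t i a = 0.
  by rewrite Uia => /negbTE -> /negbTE ->; rewrite !mulr0 addr0.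
have s1 : al + be = 1.
  by rewrite -(transition_col_sum t a) (sum_two ab) ?Uaa ?Uba.
have naa : Num.conj al * al + Num.conj be * be = 1.
  have := transition_col_dot t a a; rewrite eqxx mulr1n => <-.
  rewrite (sum_two ab) ?Uaa ?Uba // => i ia ib.
  by rewrite Uia0 // mulr0.
have nab : Num.conj al * be + Num.conj be * U t b b = 0.
  have := transition_col_dot t a b; rewrite (negbTE ab) mulr0n => <-.
  rewrite (sum_two ab) ?Uaa ?Uab ?Uba // => i ia ib.
  by rewrite Uia0 // rmorph0 mul0r.
have Ubb : U t b b = al.
  have cs1 : Num.conj al + Num.conj be = 1 by rewrite -rmorphD s1 rmorph1.
  have cross : Num.conj al * be + Num.conj be * al = 0.
    have : (Num.conj al + Num.conj be) * (al + be) = 1 by rewrite cs1 s1 mulr1.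
    by rewrite -[RHS]naa => /eqP; rewrite -subr_eq0 => /eqP <-; ring.
  have cbe0 : Num.conj be != 0 by rewrite conjC_eq0.
  by apply: (mulfI cbe0); apply: (addrI (Num.conj al * be)); rewrite nab cross.
have Uib0 i : i != a -> i != b -> U t i b = 0.
  move=> ia ib; have := transition_col_dot t b b; rewrite eqxx mulr1n.
  rewrite (bigD1 a) //= (bigD1 b) 1?eq_sym //= Uab Ubb addrA.
  rewrite [X in X + _]addrC naa -[RHS]addr0 => /addrI/eqP.
  rewrite psumr_eq0 => [/allP/(_ i (mem_index_enum _))|j _].
    by rewrite ia ib /= mulf_eq0 conjC_eq0 orbb => /eqP.
  by rewrite mulrC mul_conjC_ge0.
have Ub : U t *m vertex_vec R b = be *: vertex_vec R a + al *: vertex_vec R b.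
  apply/colP => i; rewrite -colE [LHS]mxE.
  have -> : (be *: vertex_vec R a + al *: vertex_vec R b) i 0 =
      be * (i == a)%:R + al * (i == b)%:R by rewrite !mxE !andbT.
  have [->|ia] := eqVneq i a; first by rewrite Uab (negbTE ab) mulr1 mulr0 addr0.
  have [->|ib] := eqVneq i b; first by rewrite Ubb mulr1 mulr0 add0r.
  by rewrite Uib0 // !mulr0 addr0.
split=> //.
  rewrite mulmxDr Ua Ub addrACA -!scalerDl [be + al]addrC s1 !scale1r //.
exists (al - be).
  apply/eqP => d1; move: s1; rewrite -d1 => /addrI/eqP.
  by rewrite -subr_eq0 opprK -mulr2n mulrn_eq0 (negbTE be0).
by rewrite mulmxBr Ua Ub; apply/colP => i; rewrite !mxE; ring.
Qed.

End Diagonalised.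

(** * Rationality of supports *)

Section RationalSupport.
Local Open Scope ring_scope.
Variable (C : numFieldType).

(* If d is the number of eigenvalues in the support, L^d v is a combination of
   the L^k v, k < d, over C hence over Q, since L and v are rational.  The
   resulting monic polynomial of degree d vanishes on the support, so the sum
   of the support is one of its coefficients up to sign. *)
Lemma sum_support_rational n (A : 'M[rat]_n) (v : 'cV[rat]_n)
    (Q : 'M[C]_n) (mu : 'I_n -> C) (s : seq C) :
  Q \in unitmx ->
  map_mx ratr A = invmx Q *m diag_mx (\row_l mu l) *m Q ->
  uniq s ->
  (forall x, x \in s <-> exists2 l, (Q *m map_mx ratr v) l 0 != 0 & mu l = x) ->
  exists q : rat, \sum_(x <- s) x = ratr q.
Proof.
move=> Qu AE us sP; pose f := \prod_(x <- s) ('X - x%:P).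
have [s0|s0] := eqVneq (size s) 0%N.
  by exists 0; rewrite (size0nil s0) big_nil rmorph0.
pose d := size s; pose hv := Q *m map_mx ratr v.
pose w k : 'cV[rat]_n := A ^+ k *m v.
have coord k l : (Q *m map_mx ratr (w k)) l 0 = mu l ^+ k * hv l 0.
  elim: k => [|k IH]; first by rewrite /w expr0 mul1mx expr0 mul1r.
  have -> : w k.+1 = A *m w k by rewrite /w exprS -mulmxE mulmxA.
  rewrite map_mxM AE !mulmxA mulmxV // mul1mx -mulmxA mul_diag_mx [LHS]mxE.
  by rewrite [X in X * _]mxE IH exprS mulrA.
have lin_coord (p : {poly C}) l :
    (Q *m (\sum_(k < size p) p`_k *: map_mx ratr (w k))) l 0 = p.[mu l] * hv l 0.
  rewrite mulmx_sumr summxE horner_coef mulr_suml; apply: eq_bigr => k _.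
  by rewrite -scalemxAr mxE coord mulrA.
have szf : size f = d.+1 by rewrite size_prod_XsubC.
have fmon : f`_d = 1.
  by have /monicP := monic_prod_XsubC s xpredT id; rewrite lead_coefE szf.
pose K : 'M[rat]_(d, n) := \matrix_k (w k)^T.
have dep : (map_mx (ratr : rat -> C) (w d)^T <= map_mx ratr K)%MS.
  apply/submxP; exists (\row_(k < d) (- f`_k)).
  have fv : \sum_(k < size f) f`_k *: map_mx ratr (w k) = 0.
    apply: (can_inj (mulKmx Qu)); apply/colP => l.
    rewrite lin_coord mulmx0 [RHS]mxE.
    have [->|hl] := eqVneq (hv l 0) 0; first by rewrite mulr0.
    suff /rootP -> : root f (mu l) by rewrite mul0r.
    by rewrite root_prod_XsubC; apply/sP; exists l.
  move: fv; rewrite szf big_ord_recr /= fmon scale1r => /eqP.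
  rewrite addrC addr_eq0 => /eqP /matrixP wE.
  apply/rowP => j; move: (wE j 0); rewrite !mxE summxE => ->.
  rewrite -sumrN; apply: eq_bigr => k _; rewrite !mxE.
  by rewrite mulNr.
(* Membership in a row space does not depend on the field, so the coefficients of the combination
   may be taken rational. *)
move: dep; rewrite map_submx => /submxP [D DE].
pose g0 : {poly rat} := \sum_(k < d) (D 0 k) *: 'X^k.
pose g : {poly C} := 'X^d - map_poly ratr g0.
have szg0 : (size (map_poly (ratr : rat -> C) g0) <= d)%N.
  rewrite size_map_poly; apply: (leq_trans (size_sum _ _ _)).
  apply/bigmax_leqP => k _; apply: (leq_trans (size_scale_leq _ _)).
  by rewrite size_polyXn.
have rootg x : x \in s -> root g x.
  move=> /sP [l hl <-]; apply/rootP/(mulIf hl); rewrite mul0r.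
  rewrite hornerD hornerN hornerXn mulrBl -coord.
  have -> : map_mx (ratr : rat -> C) (w d) =
            \sum_(k < d) ratr (D 0 k) *: map_mx ratr (w k).
    apply/colP => j; have /rowP/(_ j) := DE; rewrite !mxE summxE => ->.
    by rewrite rmorph_sum; apply: eq_bigr => k _; rewrite !mxE rmorphM.
  rewrite mulmx_sumr summxE /g0 rmorph_sum /= horner_sum mulr_suml -sumrB.
  apply: big1 => k _; rewrite -scalemxAr mxE coord map_polyZ hornerZ map_polyXn.
  by rewrite hornerXn mulrA subrr.
(* Both are monic of degree [d], so the difference has size at most [d], yet it vanishes at the [d]
   distinct points of [s]. *)
have gf : g - f = 0.
  apply: (roots_geq_poly_eq0 (rs := s)) => //.
    apply/allP => x xs; rewrite rootE hornerD hornerN.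
    rewrite (rootP (rootg x xs)); have /rootP -> : root f x by rewrite root_prod_XsubC.
    by rewrite subrr.
  rewrite -/d; apply/leq_sizeP => j dj; rewrite coefD coefN.
  have [->|jd] := eqVneq j d.
    rewrite fmon coefD coefN coefXn eqxx nth_default ?subr0 ?subrr //.
  have dj' : (d < j)%N by rewrite ltn_neqAle eq_sym jd.
  rewrite [f`_j]nth_default ?szf // coefD coefN coefXn (negbTE jd) nth_default ?(leq_trans szg0 dj) //.
  by rewrite ?subr0 ?(leq_trans szg0 dj).
have : g`_d.-1 = f`_d.-1 by apply/eqP; rewrite -subr_eq0 -coefN -coefD gf coef0.
rewrite coefPn_prod_XsubC // coefD coefN coefXn.
have /negbTE -> : d.-1 != d by rewrite /d; case: (size s) s0 => // k _; rewrite /= neq_ltn ltnSn.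
rewrite sub0r coef_map => /oppr_inj E.
by exists g0`_d.-1.
Qed.

End RationalSupport.

Section RationalEigenvalue.
Local Open Scope ring_scope.

Lemma rational_eigenvalue_int (F : numFieldType) n (M : 'M[int]_n)
    (q : rat) (v : 'cV[F]_n) :
  v != 0 -> map_mx intr M *m v = ratr q *: v -> exists z : int, ratr q = z%:~R :> F.
Proof.
move=> v0 Mv.
have rootF : root (char_poly (map_mx (intr : int -> F) M^T)) (ratr q).
  rewrite -eigenvalue_root_char; apply/eigenvalueP; exists v^T; last by rewrite trmx_eq0.
  by rewrite -map_trmx -trmx_mul Mv linearZ.
have rootQ : root (map_poly intr (char_poly M^T)) q.
  rewrite -(fmorph_root (ratr : rat -> F)) -map_poly_comp.
  rewrite (eq_map_poly (g := intr)) ?map_char_poly // => z /=.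
  by rewrite ratr_int.
(* The theory of algebraic integers lives in [algC]: there q is a root of a monic integer
   polynomial, and a rational algebraic integer is an integer. *)
have qint : (ratr q : algC) \in Aint.
  apply: (root_monic_Aint (p := map_poly intr (char_poly M^T))).
  - move: rootQ; rewrite -(fmorph_root (ratr : rat -> algC)) -map_poly_comp.
    by rewrite (eq_map_poly (g := intr)) // => z /=; rewrite ratr_int.
  - by apply: monic_map; exact: char_poly_monic.
  - by apply/polyOverP => k; rewrite coef_map /= rpred_int_num.
have : (ratr q : algC) \is a Num.int by apply: Cint_rat_Aint => //; exact: Crat_rat.
case/intrP => z zq; exists z.
have : ratr q = ratr z%:~R :> algC by rewrite ratr_int.
by move=> /fmorph_inj ->; rewrite ratr_int.
Qed.

End RationalEigenvalue.

(** * Revival and integer supports *)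

Section Sieve.
Local Open Scope ring_scope.
Variables (n : nat) (e : rel 'I_n).

Definition sieve_step (h c : nat) (v : 'cV[int]_n) (th : nat) : 'cV[int]_n :=
  if th == c %[mod h] then intlap e *m v - th%:Z *: v else v.

Definition sieve (N h c : nat) (v : 'cV[int]_n) : 'cV[int]_n :=
  foldl (sieve_step h c) v (iota 0 N).

Definition vsum (a b : 'I_n) : 'cV[int]_n := delta_mx a 0 + delta_mx b 0.
Definition vdiff (a b : 'I_n) : 'cV[int]_n := delta_mx a 0 - delta_mx b 0.

Definition passes (N h r : nat) (a b : 'I_n) : Prop :=
  sieve N h 0 (vsum a b) = 0 /\ sieve N h r (vdiff a b) = 0.

End Sieve.

(** * Spectral meaning of the sieve, and its equivalence with revival *)

Section Support.
Local Open Scope ring_scope.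
Local Open Scope complex_scope.
Local Open Scope sesquilinear_scope.
Variable R : realType.
Variables (n : nat) (e : rel 'I_n).
Hypotheses (e_sym : symmetric e) (e_irr : irreflexive e).
Local Notation L := (laplacian R e).
Local Notation U := (@transition R n e).

Variables (Q : 'M[R[i]]_n) (lam : 'I_n -> R).
Hypothesis Q_unitary : Q \is unitarymx.
Hypothesis LE : L = invmx Q *m diag_mx (\row_l (lam l)%:C) *m Q.

Let Q_unit : Q \in unitmx. Proof. exact: unitarymx_unit. Qed.

Definition coord (v : 'cV[int]_n) l : R[i] := (Q *m map_mx intr v) l 0.

Lemma coord_eq0 v : (forall l, coord v l = 0) -> v = 0.
Proof.
move=> v0; have : map_mx (intr : int -> R[i]) v = 0.
  apply: (coord_inj Q_unitary) => l; rewrite [LHS]v0.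
  by rewrite mulmx0 mxE.
move=> /colP E; apply/colP => i; move: (E i); rewrite !mxE => /eqP.
by rewrite intr_eq0 => /eqP.
Qed.

Lemma coord_step v th l :
  coord (intlap e *m v - th%:Z *: v) l = ((lam l)%:C - th%:R) * coord v l.
Proof.
rewrite /coord map_mxB map_mxM -intlapE map_mxZ mulmxBr mulrBl.
rewrite [LHS]mxE [X in _ + X]mxE -scalemxAr [X in _ - X]mxE; congr (_ - _).
by rewrite LE; exact: coord_diag.
Qed.

Lemma coord_sieve N h c v l :
  coord (sieve e N h c v) l =
  \prod_(th < N | th == c %[mod h]) ((lam l)%:C - th%:R) * coord v l.
Proof.
rewrite /sieve; elim: N => [|N IH]; first by rewrite big_ord0 mul1r.
rewrite -[X in iota 0 X]addn1 iotaD add0n foldl_cat /= {1}/sieve_step.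
rewrite big_mkcond big_ord_recr /= -big_mkcond /=.
by case: ifP => _; rewrite ?mulr1 // coord_step IH mulrA [_ * (_ - _)]mulrC.
Qed.

(** In eigencoordinates the sieve multiplies coordinate l by the product of the [lam l - th] over
    the class, which is zero exactly when [lam l] is one of these [th]. Integer arithmetic thus
    locates a support without computing any eigenvalue. *)
Lemma sieve_eq0P N h c v : sieve e N h c v = 0 <->
  forall l, coord v l != 0 ->
    exists th : nat, [/\ (th < N)%N, th = c %[mod h] & lam l = th%:R].
Proof.
split=> [s0 l vl | H].
  have : coord (sieve e N h c v) l = 0 by rewrite s0 /coord map_mx0 mulmx0 mxE.
  rewrite coord_sieve => /eqP; rewrite mulf_eq0 (negbTE vl) orbF.
  move=> /prodf_eq0 [th /eqP thc]; rewrite subr_eq0 => /eqP lth.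
  exists th; split=> //.
  by apply: (@complexI R); rewrite lth rmorph_nat.
apply: coord_eq0 => l; rewrite coord_sieve.
have [->|/H [th [thN thc lth]]] := eqVneq (coord v l) 0; first by rewrite mulr0.
rewrite (bigD1 (Ordinal thN)) /= ?thc //.
by rewrite lth rmorph_nat subrr !mul0r.
Qed.

Lemma map_vsum (a b : 'I_n) :
  map_mx intr (vsum a b) = vertex_vec R a + vertex_vec R b.
Proof. by rewrite map_mxD !map_delta_mx. Qed.

Lemma map_vdiff (a b : 'I_n) :
  map_mx intr (vdiff a b) = vertex_vec R a - vertex_vec R b.
Proof. by rewrite map_mxB !map_delta_mx. Qed.

Lemma proper_revival_coordP a b t : proper_revival e a b t <->
  [/\ a != b,
      forall l, coord (vsum a b) l != 0 -> cis (t * lam l) = 1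
    & exists2 g, g != 1 &
        forall l, coord (vdiff a b) l != 0 -> cis (t * lam l) = g].
Proof.
rewrite (proper_revivalP e_sym Q_unitary LE) -map_vsum -map_vdiff.
split=> [[ab /esym Eu [g g1 Ew]] | [ab Eu [g g1 Ew]]]; split=> //.
- apply/(transition_eigenP Q_unitary LE); rewrite -Eu scale1r //.
- by exists g => //; apply/(transition_eigenP Q_unitary LE).
- by rewrite -[RHS]scale1r; apply/(transition_eigenP Q_unitary LE).
- by exists g => //; apply/(transition_eigenP Q_unitary LE).
Qed.

Definition eigvec l : 'cV[R[i]]_n := col l (invmx Q).

Lemma eigvec_neq0 l : eigvec l != 0.
Proof.
apply/eqP => v0; have : Q *m eigvec l = 0 by rewrite v0 mulmx0.
rewrite /eigvec colE mulmxA mulmxV // mul1mx => /colP/(_ l); rewrite !mxE eqxx => /eqP.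
by rewrite oner_eq0.
Qed.

Lemma eigvecE l : L *m eigvec l = (lam l)%:C *: eigvec l.
Proof.
rewrite {1}LE /eigvec {1}colE mulmxA mulmxK // -colE mul_mx_diag.
by apply/colP => i; rewrite !mxE mulrC.
Qed.

Lemma rational_lam_int l (q : rat) : lam l = ratr q -> exists z : int, lam l = z%:~R.
Proof.
move=> lq; have := @rational_eigenvalue_int R[i] n (intlap e) q _ (eigvec_neq0 l).
rewrite -intlapE eigvecE lq fmorph_rat => /(_ erefl) [z zE].
by exists z; apply: (@complexI R); rewrite fmorph_rat zE rmorph_int.
Qed.

Lemma deg_le i : (deg e i <= n)%N.
Proof. by rewrite -[leqRHS]card_ord; exact: max_card. Qed.

(* Gershgorin's disc around the i-th diagonal entry, i being an index where
   the eigenvector is largest. *)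
Lemma lam_bounds l : 0 <= lam l <= (2 * n)%:R.
Proof.
have [i0 vi0] : exists i, eigvec l i 0 != 0.
  apply/existsP; move: (eigvec_neq0 l); apply: contraR.
  rewrite negb_exists => /forallP v0; apply/eqP/colP => i.
  by rewrite [RHS]mxE; apply/eqP; have := v0 i; rewrite negbK.
pose x i := Normc.normc (eigvec l i 0).
pose i := [arg max_(j > i0) x j]%O.
have imax j : x j <= x i by rewrite /i; case: arg_maxP => // k _; apply.
have xC j : `|eigvec l j 0| = (x j)%:C by [].
have vi : eigvec l i 0 != 0.
  rewrite -normr_gt0 xC; apply: lt_le_trans (_ : (x i0)%:C <= _); last by rewrite lecR.
  by rewrite -xC normr_gt0.
have xi0 : 0 < x i by rewrite -ltcR -xC normr_gt0.
have rowi : ((lam l)%:C - (deg e i)%:R) * eigvec l i 0 =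
            - \sum_j (e i j)%:R * eigvec l j 0.
  have /matrixP/(_ i 0) := eigvecE l; rewrite [RHS]mxE [LHS]mxE.
  move=> E; rewrite mulrBl -E -sumrN intlapE.
  under eq_bigr do rewrite mxE mxE rmorphB /= rmorphMn /= mulrBl.
  rewrite sumrB (bigD1 i) //= eqxx mulr1n big1 ?addr0 => [|j /negbTE ji].
    rewrite -pmulrn addrC addrA addNr add0r -sumrN.
    by apply: eq_bigr => j _; rewrite -pmulrn.
  by rewrite eq_sym ji mulr0n mul0r.
have : `|(lam l)%:C - (deg e i)%:R| <= (deg e i)%:R.
  rewrite -(ler_pM2r (_ : 0 < `|eigvec l i 0|)) ?normr_gt0 // -normrM rowi normrN.
  apply: (le_trans (ler_norm_sum _ _ _)).
  rewrite /deg -sum1_card natr_sum mulr_suml [leRHS]big_mkcond /=.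
  apply: ler_sum => j _; rewrite inE; case: (e i j); last by rewrite mul0r normr0.
  by rewrite !mul1r !xC lecR.
rewrite -(rmorph_nat (real_complex R)) -rmorphB /=.
rewrite normc_def /= expr0n addr0 sqrtr_sqr lecR ler_distl subrr.
move=> /andP[-> /le_trans -> //]; rewrite -natrD ler_nat.
by rewrite mul2n -addnn leq_add ?deg_le.
Qed.

Lemma coord_vdiff_neq0 a b : a != b -> exists l, coord (vdiff a b) l != 0.
Proof.
move=> ab; have [/existsP //|/existsPn w0] := boolP [exists l, coord (vdiff a b) l != 0].
have /colP/(_ a) : vdiff a b = 0.
  by apply: coord_eq0 => l; apply/eqP; have := w0 l; rewrite negbK.
by rewrite !mxE !eqxx (negbTE ab).
Qed.

Lemma passes_revival N h r a b t : a != b -> passes e N h r a b ->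
  cis (t * r%:R) != 1 :> R[i] ->
  (forall th : nat, (th < N)%N -> th = 0 %[mod h] -> cis (t * th%:R) = 1 :> R[i]) ->
  (forall th : nat, (th < N)%N -> th = r %[mod h] ->
     cis (t * th%:R) = cis (t * r%:R) :> R[i]) ->
  proper_revival e a b t.
Proof.
move=> ab [/sieve_eq0P su /sieve_eq0P sw] tr c0 cr.
apply/proper_revival_coordP; split=> //.
  by move=> l /su [th [thN thc ->]]; exact: c0.
by exists (cis (t * r%:R)) => // l /sw [th [thN thc ->]]; exact: cr.
Qed.

Lemma support_sum_rational v : exists (T : seq R) (q : rat),
  [/\ forall x, x \in T <-> exists2 l, coord v l != 0 & lam l = x
    , uniq T & \sum_(x <- T) x = ratr q].
Proof.
(* Repetitions are removed because the polynomial behind [sum_support_rational] has simple roots. *)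
pose T := undup [seq lam l | l <- enum 'I_n & coord v l != 0].
have TP x : x \in T <-> exists2 l, coord v l != 0 & lam l = x.
  rewrite mem_undup; split=> [/mapP [l]|[l vl <-]].
    by rewrite mem_filter => /andP[vl _] ->; exists l.
  by apply: map_f; rewrite mem_filter vl mem_enum.
have AE : map_mx (ratr : rat -> R[i]) (map_mx intr (intlap e)) =
   invmx Q *m diag_mx (\row_l (lam l)%:C) *m Q.
  by rewrite -LE intlapE -map_mx_comp; apply/matrixP => i j; rewrite !mxE /= ratr_int.
have vE : map_mx (ratr : rat -> R[i]) (map_mx intr v) = map_mx intr v.
  by rewrite -map_mx_comp; apply/matrixP => i j; rewrite !mxE /= ratr_int.
have [|x|q qE] := @sum_support_rational R[i] n _ (map_mx intr v) Q _
    [seq x%:C | x <- T] Q_unit AE.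
- by rewrite map_inj_uniq ?undup_uniq //; exact: complexI.
- rewrite vE; split=> [/mapP [y /TP [l vl <-] ->]|[l vl <-]]; first by exists l.
  by apply: map_f; apply/TP; exists l.
exists T, q; split=> //; first exact: undup_uniq.
apply: (@complexI R); rewrite fmorph_rat -qE big_map.
by rewrite rmorph_sum.
Qed.

(** Off {a, b} the row equation says that neither a nor b has a neighbour there, and in rows a and b
    it makes both degrees equal to [e a b]. So {a, b} is a component K_2 or a pair of isolated
    vertices. *)
Lemma kernel_vsum a b : a != b -> intlap e *m vsum a b = 0 ->
  intlap e *m vdiff a b = (2 * e a b)%:Z *: vdiff a b.
Proof.
move=> ab; rewrite /vsum /vdiff mulmxDr mulmxBr -!colE => /colP K.
have ent i : [/\ (col a (intlap e)) i 0 = (deg e i)%:Z *+ (i == a) - (e i a)%:Z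
   & (col b (intlap e)) i 0 = (deg e i)%:Z *+ (i == b) - (e i b)%:Z].
  by rewrite !mxE.
have eba : e b a = e a b by rewrite e_sym.
apply/colP => i; move: (K i); rewrite [RHS]mxE [LHS]mxE.
rewrite [in X in _ -> X = _]mxE [in X in _ -> _ + X = _]mxE.
have -> : ((2 * e a b)%:Z *: (delta_mx a 0 - delta_mx b 0) : 'cV[int]_n) i 0 =
  (2 * e a b)%:Z * ((i == a)%:R - (i == b)%:R) by rewrite !mxE !andbT.
case: (ent i) => -> ->.
have [->|ia] := eqVneq i a.
  rewrite (negbTE ab) e_irr /=; case: (e a b); lia.
have [->|ib] := eqVneq i b; first by rewrite e_irr /= eba; case: (e a b); lia.
by case: (e i a); case: (e i b) => //=; lia.
Qed.

(** The first alternative is the component K_2, where e_a - e_b has eigenvalue 2, whence r = 2. The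
    modulus 2 n + 4 is 2 + (2 n + 2), the largest one that the search tries with this residue; it
    exceeds every [th] tested. *)
Lemma revival_passes a b (s : R) : proper_revival e a b s ->
  passes e (2 * n + 2) (2 * n + 4) 2 a b \/
  exists (h r : nat) (m : int),
    [/\ (0 < r < h)%N, (h <= 2 * n)%N, passes e (2 * n + 2) h r a b,
        m != 0 & s * h%:R = 2 * pi * m%:~R].
Proof.
move=> /proper_revival_coordP [ab hu [g g1 hw]].
have [l1 wl1] := coord_vdiff_neq0 ab.
have lam_lt l (z : int) : lam l = z%:~R -> exists2 th : nat, z = th & (th < 2 * n + 2)%N.
  move=> lz; have := lam_bounds l; rewrite lz ler0z pmulrn ler_int.
  by case: z {lz} => // th /andP[_ thn]; exists th => //; lia.
have s0 : s != 0.
  by apply: contraNneq g1 => s0; rewrite -(hw _ wl1) s0 mul0r cis0.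
have [/forallP all0|] := boolP [forall l, (coord (vsum a b) l != 0) ==> (lam l == 0)].
  left.
  have Ku : intlap e *m vsum a b = 0.
    rewrite -[LHS]subr0 -[X in _ - X](scale0r (vsum a b)).
    apply: coord_eq0 => l; rewrite (coord_step _ 0) subr0.
    have [->|ul] := eqVneq (coord (vsum a b) l) 0; first by rewrite mulr0.
    by have /implyP/(_ ul)/eqP -> := all0 l; rewrite mul0r.
  have Kw := kernel_vsum ab Ku.
  have wlam l : coord (vdiff a b) l != 0 -> lam l = (2 * e a b)%:R.
    move=> wl; apply: (@complexI R); apply/eqP; rewrite rmorph_nat -subr_eq0.
    apply/eqP/(mulIf wl); rewrite -coord_step Kw subrr mul0r.
    by rewrite /coord map_mx0 mulmx0 mxE.
  (* Otherwise both vertices are isolated, e_a - e_b also has eigenvalue 0, and [g] would be 1. *)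
  have eab : e a b.
    apply: contraNT g1 => /negbTE eab; rewrite -(hw _ wl1) (wlam _ wl1) eab.
    by rewrite mulr0 cis0.
  have n0 : (0 < n)%N by case: (a) => j; apply: leq_ltn_trans.
  split; apply/sieve_eq0P => l ul.
    exists 0%N; split=> //; first by lia.
    by have /implyP/(_ ul)/eqP := all0 l.
  exists 2%N; split=> //; first by lia.
  by rewrite wlam // eab.
rewrite negb_forall => /existsP [l0]; rewrite negb_imply => /andP[ul0 laml0]; right.
have pi0 : (2 * pi : R) != 0 by rewrite mulf_neq0 ?pnatr_eq0 // gt_eqF // pi_gt0.
(* The common unit: every eigenvalue supporting e_a + e_b is an integer multiple of it. *)
pose kap : R := 2 * pi / s.
have kapP x (m : int) : s * x = 2 * pi * m%:~R -> x = kap * m%:~R.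
  by move=> E; apply: (mulfI s0); rewrite E /kap; field.
have [q kq] : exists q : rat, kap = ratr q.
  have [T [q [TP uT sT]]] := support_sum_rational (vsum a b).
  have Tm x : x \in T -> exists m : int, x = kap * m%:~R.
    by move=> /TP [l /hu /cis_eq1 [m /kapP ->] <-]; exists m.
  have [M TM] : exists M : int, \sum_(x <- T) x = kap * M%:~R.
    rewrite big_seq; elim/big_ind: _ => [|x y [m1 ->] [m2 ->]|x /Tm] //.
      by exists 0; rewrite mulr0.
    by exists (m1 + m2); rewrite intrD mulrDr.
  (* Positivity makes the integer factor [M] of [kap] nonzero, so that [kap] is the quotient of two
     rationals. *)
  have pos : 0 < \sum_(x <- T) x.
    have l0T : lam l0 \in T by apply/TP; exists l0.
    rewrite (big_rem _ l0T) /= ltr_pwDl //.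
      by rewrite lt_neqAle eq_sym laml0; case/andP: (lam_bounds l0).
    rewrite big_seq; apply: sumr_ge0 => x /mem_rem /TP [l _ <-].
    by case/andP: (lam_bounds l).
  have M0 : M%:~R != 0 :> R.
    by apply: contraTneq pos => M0; rewrite TM M0 mulr0 ltxx.
  exists (q / M%:~R); rewrite rmorphM fmorphV /= ratr_int -sT TM.
  by rewrite mulfK.
have u_int l : coord (vsum a b) l != 0 -> exists z : int, lam l = z%:~R.
  move=> /hu /cis_eq1 [m /kapP lE]; apply: (@rational_lam_int _ (q * m%:~R)).
  by rewrite lE kq rmorphM /= ratr_int.
(* These integers form an ideal. It contains the nonzero eigenvalue at [l0], and its least positive
   element [h] is the modulus sought. *)
pose per (z : int) := exists m : int, s * z%:~R = 2 * pi * m%:~R.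
have perD x y : per x -> per y -> per (x + y).
  by move=> [m1 E1] [m2 E2]; exists (m1 + m2); rewrite [in LHS]intrD mulrDr E1 E2 -mulrDr -intrD.
have perM x k : per x -> per (x * k).
  by move=> [m E]; exists (m * k); rewrite !intrM mulrA E mulrA. 
have ex_h : exists h : nat, `[< (0 < h)%N /\ per h >].
  have [z lz] := u_int _ ul0; have [th zth _] := lam_lt _ _ lz.
  exists th; apply/asboolP; split.
    by rewrite lt0n; apply: contraNneq laml0 => th0; rewrite lz zth th0.
  by have /cis_eq1 [m mE] := hu _ ul0; exists m; rewrite -zth -lz.
pose h := ex_minn ex_h.
have [h0 perh hmin] : [/\ (0 < h)%N, per h & forall k : nat, (0 < k)%N -> per k -> (h <= k)%N].
  rewrite /h; case: ex_minnP => k /asboolP [k0 pk] kmin; split=> // j j0 pj.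
  by apply: kmin; apply/asboolP.
have per_dvd z : per z -> (h %| z)%Z.
  move=> pz; have hz : h%:Z != 0 by lia.
  have pr : per (z %% h)%Z.
    have -> : (z %% h)%Z = z + h%:Z * - (z %/ h)%Z.
      by rewrite {2}(divz_eq z h) mulrN mulrC addrC addKr.
    by apply: perD => //; exact: perM.
  have hgt0 : 0 < h%:Z by lia.
  apply/dvdz_mod0P; move: pr (modz_ge0 z hz) (ltz_pmod z hgt0).
  case: (z %% h)%Z => // -[//|k] pk _.
  by have := hmin k.+1 isT pk; lia.
have [zw1 lw1] : exists z : int, lam l1 = z%:~R.
  have wdiff l : coord (vdiff a b) l != 0 ->
      exists m : int, lam l = lam l1 + kap * m%:~R.
    move=> wl; have : cis (s * (lam l - lam l1)) = 1 :> R[i].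
      rewrite mulrBr cisD cisN (hw _ wl) (hw _ wl1) -(hw _ wl1); exact: cis_conj.
    move=> /cis_eq1 [m /kapP mE]; exists m; rewrite -mE; ring.
  have [T [q' [TP uT sT]]] := support_sum_rational (vdiff a b).
  have Tm x : x \in T -> exists m : int, x = lam l1 + kap * m%:~R.
    by move=> /TP [l /wdiff [m mE] <-]; exists m.
  (* Modulo multiples of [kap] every eigenvalue supporting e_a - e_b equals [lam l1], so the
     rational sum determines [size T] times [lam l1]. *)
  have [M TM] : exists M : int, \sum_(x <- T) x = (size T)%:R * lam l1 + kap * M%:~R.
    elim: (T) Tm => [_|x T' IH Tm]; first by exists 0; rewrite big_nil mul0r mulr0 addr0.
    have [y yT|M ME] := IH; first by apply: Tm; rewrite inE yT orbT.
    have [|m mE] := Tm x; first by rewrite inE eqxx.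
    exists (m + M); rewrite big_cons ME mE /= -[(_.+1)%:R]natr1 intrD; ring.
  have T0 : (size T)%:R != 0 :> R.
    rewrite pnatr_eq0 size_eq0; apply/eqP => T0.
    have /TP : exists2 l, coord (vdiff a b) l != 0 & lam l = lam l1 by exists l1.
    by rewrite T0.
  apply: (@rational_lam_int _ ((q' - q * M%:~R) / (size T)%:R)).
  rewrite rmorphM fmorphV rmorphB rmorphM /= ratr_int ratr_nat -kq -sT TM.
  by field.
pose r := `|(zw1 %% h)%Z|%N.
have hz : h%:Z != 0 by lia.
have rE : r = (zw1 %% h)%Z :> int by rewrite /r gez0_abs // modz_ge0.
have rh : (r < h)%N by rewrite -ltz_nat rE ltz_pmod //; lia.
(* If [h] divided [zw1], the phase on e_a - e_b would be 1. *)
have r0 : (0 < r)%N.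
  rewrite lt0n; apply: contraNneq g1 => r0; rewrite -(hw _ wl1) lw1.
  move: rE; rewrite r0 => /esym/dvdz_mod0P /dvdzP [k zk].
  by have [m mE] := perM _ k perh; rewrite zk [k * _]mulrC mE cis_int eqxx.
have [z0 lz0] := u_int _ ul0; have [th0 zth0 th0N] := lam_lt _ _ lz0.
have lam_per l z : lam l = z%:~R -> cis (s * lam l) = 1 :> R[i] -> (h %| z)%Z.
  by move=> lz /cis_eq1 [m mE]; apply: per_dvd; exists m; rewrite -lz.
(* [h] divides the nonzero eigenvalue at [l0], which is at most 2 n. *)
have h2n : (h <= 2 * n)%N.
  have := lam_per _ _ lz0 (hu _ ul0); rewrite zth0 dvdzE /= => /dvdn_leq hle.
  have th00 : (0 < th0)%N by rewrite lt0n; apply: contraNneq laml0 => E; rewrite lz0 zth0 E.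
  have := lam_bounds l0; rewrite lz0 zth0 pmulrn ler_int => /andP[_].
  by have := hle th00; lia.
have [m mE] := perh.
exists h, r, m; split=> //; first by rewrite r0.
- split; apply/sieve_eq0P => l vl.
    have [z lz] := u_int _ vl; have [th zth thN] := lam_lt _ _ lz.
    exists th; split=> //; last by rewrite lz zth.
    have := lam_per _ _ lz (hu _ vl); rewrite zth dvdzE /= => /eqP ->.
    by rewrite mod0n.
  have [m' mE'] : exists m' : int, s * (lam l - lam l1) = 2 * pi * m'%:~R.
    apply: cis_eq1; rewrite mulrBr cisD cisN (hw _ vl) (hw _ wl1) -(hw _ wl1).
    exact: cis_conj.
  have [z lz] : exists z : int, lam l = z%:~R.
    apply: (@rational_lam_int _ (zw1%:~R + q * m'%:~R)).
    rewrite rmorphD rmorphM /= !ratr_int -kq -lw1 -(kapP _ _ mE').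
    by rewrite addrC subrK.
  have [th zth thN] := lam_lt _ _ lz.
  exists th; split=> //; last by rewrite lz zth.
  have /per_dvd : per (z - zw1) by exists m'; rewrite intrB -lz -lw1.
  rewrite -eqz_mod_dvd zth -(modz_mod zw1) -rE !modz_nat => /eqP.
  by case.
- apply: contraNneq s0 => m0; move: mE; rewrite m0 mulr0 => /eqP.
  by rewrite mulf_eq0 intr_eq0 => /orP[//|/eqP [h00]]; move: h0; rewrite h00.
Qed.

Lemma proper_revival_sym a b (t : R) : proper_revival e a b t -> proper_revival e b a t.
Proof.
rewrite !(proper_revivalP e_sym Q_unitary LE) => -[ab Us [g g1 Ud]].
split; [by rewrite eq_sym | by rewrite [_ b + _]addrC | exists g => //].
by rewrite -opprB mulmxN Ud scalerN.
Qed.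

Lemma cis_neq1 (x : R) : 0 < x < 2 * pi -> cis x != 1 :> R[i].
Proof.
move=> /andP[x0 x2]; apply/eqP => /cis_eq1 [m xm].
have pi0 : 0 < 2 * pi :> R by rewrite mulr_gt0 // pi_gt0.
move: x0; rewrite xm pmulr_rgt0 // ltr0z => m0.
move: x2; rewrite xm -[ltRHS]mulr1 ltr_pM2l // -[1](mulr1z 1) ltr_int.
by lia.
Qed.

(** The factor [1%:R] is the numerator p = 1 of the output format 1, p, q. *)
Lemma passes_revival_period N h r a b : a != b -> (0 < r < h)%N ->
  passes e N h r a b -> proper_revival e a b (2 * pi * 1%:R / h%:R : R).
Proof.
move=> ab /andP[r0 rh] pas.
have h0 : 0 < h%:R :> R by rewrite ltr0n; lia.
have pi0 : 0 < 2 * pi :> R by rewrite mulr_gt0 // pi_gt0.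
have per (q : nat) : cis (2 * pi * 1%:R / h%:R * (q * h)%:R) = 1 :> R[i].
  rewrite -(cis_int R q) natrM; congr cis; rewrite -pmulrn.
  by field; rewrite gt_eqF.
apply: (passes_revival ab pas) => [|th _ th0|th _ thr].
- apply: cis_neq1; rewrite mulr1 mulr_gt0 ?divr_gt0 ?ltr0n //=; last first.
    by lia.
  by rewrite mulrAC ltr_pdivrMr // ltr_pM2l // ltr_nat.
- by rewrite (divn_eq th h) th0 mod0n addn0 per.
- rewrite (divn_eq th h) thr (modn_small rh) natrD mulrDr cisD per mul1r.
  by [].
Qed.

(** Since [th < N <= h], a class modulo [h] contains no candidate besides its least residue. The
    phases are then 1 and [cis (t * r)], whatever the period. *)
Lemma passes_revival_small N h r a b (t : R) : a != b -> (0 < r < h)%N -> (N <= h)%N ->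
  passes e N h r a b -> 0 < t -> t * r%:R < 2 * pi -> proper_revival e a b t.
Proof.
move=> ab /andP[r0 rh] Nh pas t0 t2.
apply: (passes_revival ab pas) => [|th thN|th thN].
- by apply: cis_neq1; rewrite t2 mulr_gt0 ?ltr0n.
- by rewrite modn_small ?mod0n ?(leq_trans thN) // => ->; rewrite mulr0 cis0.
- by rewrite !modn_small ?(leq_trans thN) // => ->.
Qed.

End Support.

(** * From the largest successful modulus to the answer *)

Section SearchAnswer.
Local Open Scope ring_scope.
Variable R : realType.
Variables (n : nat) (e : rel 'I_n).
Hypotheses (e_sym : symmetric e) (e_irr : irreflexive e).

(** Soundness, then maximality. The ranges of r, d and b < a are those of the nested loops of the
    program, with modulus r + d; 0 stands for failure of all tests. *)
Definition search_result (res : nat) : Prop :=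
  (res = 0%N \/ exists (r : nat) (a b : 'I_n),
     [/\ a != b, (0 < r < res)%N & passes e (2 * n + 2) res r a b]) /\
  (forall (r d : nat) (a b : 'I_n), (0 < r <= 2 * n + 2)%N ->
     (0 < d <= 2 * n + 2)%N -> (b < a)%N ->
     passes e (2 * n + 2) (r + d) r a b -> (r + d <= res)%N).

Lemma search_result_answer res : search_result res ->
  revival_answer R e
    (if res == 0%N then [:: 0%N]
     else if (2 * n + 2 < res)%N then [:: 2%N] else [:: 1%N; 1%N; res]).
Proof.
move=> [found maximal]; have [Q [lam [Qu LE]]] := laplacian_diag R e_sym.
have hpi : 0 < 2 * pi :> R by rewrite mulr_gt0 // pi_gt0.
have compl (s : R) : revival_at e s -> (2 * n + 2 < res)%N \/
    exists (h : nat) (m : int), [/\ (0 < h <= res)%N, m != 0 & s * h%:R = 2 * pi * m%:~R].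
  move=> [a [b rev]].
  (* The search visits each unordered pair once; revival is symmetric in its two vertices. *)
  wlog ba : a b rev / (b < a)%N.
    move=> W; have [ab _] := rev.
    have [ab'|ba'|/val_inj abE] := ltngtP a b; last by rewrite abE eqxx in ab.
      by apply: (W b a) => //; exact: (proper_revival_sym e_sym Qu LE).
    exact: (W a b).
  have [p2|[h [r [m [/andP[r0 rh] h2n pas m0 E]]]]] :=
    revival_passes e_sym e_irr Qu LE rev.
    left; have := maximal 2%N (2 * n + 2)%N a b.
    have -> : (2 + (2 * n + 2) = 2 * n + 4)%N by lia.
    have r2 : (0 < 2 <= 2 * n + 2)%N by lia.
    have d2 : (0 < 2 * n + 2 <= 2 * n + 2)%N by lia.
    by move=> /(_ r2 d2 ba p2); lia.
  right; exists h, m; split=> //.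
  have := maximal r (h - r)%N a b; rewrite subnKC ?(ltnW rh) // => -> //; lia.
have [res0|res0] := eqVneq res 0%N.
  apply: Or31; split=> // -[s /compl [|[h [m [/andP[h0]]]]]]; rewrite res0 //.
  by rewrite leqn0 => /eqP hh; rewrite hh in h0.
have [|[r [a [b [ab rres pas]]]]] := found; first by move=> E; rewrite E in res0.
have [big|small] := ltnP.
  apply: Or33; split=> //.
    by exists (2 * pi * 1%:R / res%:R), a, b; exact: (passes_revival_period e_sym Qu LE ab rres pas).
  move=> [tau [tau0 [a' [b' rev]] taumin]].
  have r0 : 0 < r%:R :> R by rewrite ltr0n; lia.
  have taupos : 0 < tau.
    rewrite lt_neqAle tau0 andbT eq_sym; apply/eqP => tauE.
    move: rev; rewrite tauE => /(proper_revival_coordP e_sym Qu LE) [ab' _ [g g1 gw]].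
    have [l wl] := coord_vdiff_neq0 Qu ab'.
    by move: g1; rewrite -(gw l wl) mul0r cis0 eqxx.
  (* The first bound undercuts the alleged minimum, the second keeps t r below 2 pi. *)
  pose t := Num.min (tau / 2) (pi / r%:R).
  have t0 : 0 < t by rewrite lt_min !divr_gt0 // pi_gt0.
  have ttau : t < tau.
    by rewrite gt_min ltr_pdivrMr // mulr_natr mulr2n ltrDl taupos.
  have tr : t * r%:R < 2 * pi.
    apply: (le_lt_trans (_ : _ <= pi)); last by rewrite mulr_natl mulr2n ltrDl pi_gt0.
    by rewrite -ler_pdivlMr // ge_min lexx orbT.
  have := taumin t (ltW t0); rewrite leNgt ttau => /(_ _)/negP; apply=> //.
  exists a, b; apply: (passes_revival_small e_sym Qu LE ab rres _ pas t0 tr).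
  exact: ltnW.
apply: Or32; exists 1%N, res; split=> //; first by rewrite lt0n.
have resR : 0 < res%:R :> R by rewrite ltr0n lt0n.
split.
- by rewrite mulr1 divr_ge0 // ltW.
- by exists a, b; exact: (passes_revival_period e_sym Qu LE ab rres pas).
- move=> s s0 /compl [|[h [m [/andP[h0 hres] m0 sE]]]]; first by rewrite ltnNge small.
  have hR : 0 < h%:R :> R by rewrite ltr0n.
  (* s >= 0 excludes negative m, and m is a nonzero integer. *)
  have mR : 1 <= m%:~R :> R.
    have : 0 <= m%:~R :> R.
      by rewrite -(pmulr_rge0 _ hpi) -sE mulr_ge0 // ltW.
    by rewrite ler0z -[1](mulr1z 1) ler_int; lia.
  rewrite mulr1; apply: (le_trans (_ : _ <= 2 * pi / h%:R)).
    by rewrite ler_pM2l // lef_pV2 ?posrE // ler_nat.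
  by rewrite ler_pdivrMr // sE ler_peMr // ltW.
Qed.

End SearchAnswer.

(** * A structured language for the machine *)

(* A structured language compiled to the machine.  Scalars and the heap are
   separate name spaces, and [CLoop x c] fetches its iteration count once, so
   that every command has a total functional semantics. *)
Inductive cmd : Type :=
| CConst of nat & nat
| CAdd of nat & nat & nat
| CSub of nat & nat & nat
| CLoad of nat & nat
| CStore of nat & nat
| CRead of nat
| CWrite of nat
| CSeq of cmd & cmd
| CIf of nat & cmd
| CLoop of nat & cmd.

Record cstate := CState {
  sc : nat -> nat;
  hp : nat -> nat;
  cinp : seq nat;
  cout : seq nat
}.

Definition set_sc (s : cstate) (x v : nat) : cstate :=
  CState [eta sc s with x |-> v] (hp s) (cinp s) (cout s).

Definition set_hp (s : cstate) (p v : nat) : cstate :=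
  CState (sc s) [eta hp s with p |-> v] (cinp s) (cout s).

Fixpoint den (c : cmd) (s : cstate) : cstate :=
  match c with
  | CConst x k => set_sc s x k
  | CAdd x y z => set_sc s x (sc s y + sc s z)
  | CSub x y z => set_sc s x (sc s y - sc s z)
  | CLoad x y => set_sc s x (hp s (sc s y))
  | CStore x y => set_hp s (sc s x) (sc s y)
  | CRead x => CState [eta sc s with x |-> head 0 (cinp s)] (hp s)
                 (behead (cinp s)) (cout s)
  | CWrite x => CState (sc s) (hp s) (cinp s) (rcons (cout s) (sc s x))
  | CSeq c1 c2 => den c2 (den c1 s)
  | CIf x c1 => if sc s x == 0 then s else den c1 s
  | CLoop x c1 => iter (sc s x) (den c1) s
  end.

(** Exact count of machine steps. A loop costs two instructions of set-up and one final test; each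
    round adds a test, two instructions to decrement the counter and the jump back. *)
Fixpoint ctime (c : cmd) (s : cstate) : nat :=
  match c with
  | CLoad _ _ | CStore _ _ => 3
  | CSeq c1 c2 => ctime c1 s + ctime c2 (den c1 s)
  | CIf x c1 => (if sc s x == 0 then 0 else ctime c1 s).+1
  | CLoop x c1 =>
      3 + \sum_(k < sc s x) (4 + ctime c1 (iter k (den c1) s))
  | _ => 1
  end.

(* Register layout: [0, scratch[ scalars, [scratch] addresses and constants,
   then one counter per loop nesting level, and the heap from [heap_base]. *)
Definition scratch := 32.
Definition counter (d : nat) := 33 + d.
(** Leaves eleven loop counters, the registers 33 to 43; the search nests seven loops. *)
Definition heap_base := 44.

Fixpoint csize (c : cmd) : nat :=
  match c with
  | CLoad _ _ | CStore _ _ => 3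
  | CSeq c1 c2 => csize c1 + csize c2
  | CIf _ c1 => (csize c1).+1
  | CLoop _ c1 => csize c1 + 6
  | _ => 1
  end.

(** Jump targets are absolute, hence [base]. The machine has neither a copy nor a decrement
    instruction: a loop copies its count by adding a zero held in [scratch] and decrements by a one
    held there. *)
Fixpoint compile (d base : nat) (c : cmd) : ram_program :=
  match c with
  | CConst x k => [:: Const x k]
  | CAdd x y z => [:: Add x y z]
  | CSub x y z => [:: Defs.Sub x y z]
  | CLoad x y =>
      [:: Const scratch heap_base; Add scratch scratch y; LoadAt x scratch]
  | CStore x y =>
      [:: Const scratch heap_base; Add scratch scratch x; StoreAt scratch y]
  | CRead x => [:: Read x]
  | CWrite x => [:: Write x]
  | CSeq c1 c2 => compile d base c1 ++ compile d (base + csize c1) c2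
  | CIf x c1 =>
      JumpZero x (base + csize c1 + 1) :: compile d base.+1 c1
  | CLoop x c1 =>
      [:: Const scratch 0; Add (counter d) x scratch;
          JumpZero (counter d) (base + csize c1 + 6);
          Const scratch 1; Defs.Sub (counter d) (counter d) scratch]
      ++ compile d.+1 (base + 5) c1 ++ [:: Jump (base + 2)]
  end.

(** A store must not hit the counters of the enclosing loops, which is why it too carries a bound on
    [counter d]. *)
Fixpoint wf (d : nat) (c : cmd) : bool :=
  match c with
  | CConst x _ | CRead x | CWrite x => x < scratch
  | CAdd x y z | CSub x y z => [&& x < scratch, y < scratch & z < scratch]
  | CLoad x y => (x < scratch) && (y < scratch)
  | CStore x y => [&& x < scratch, y < scratch & counter d <= heap_base]
  | CSeq c1 c2 => wf d c1 && wf d c2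
  | CIf x c1 => (x < scratch) && wf d c1
  | CLoop x c1 => [&& x < scratch, counter d < heap_base & wf d.+1 c1]
  end.

(** * Correctness of the compilation *)

Definition represents (s : cstate) (m : ram_state) : Prop :=
  [/\ forall x, x < scratch -> reg m x = sc s x,
      forall p, reg m (heap_base + p) = hp s p,
      inp m = cinp s & out m = cout s].

Definition code_at (P : ram_program) (b : nat) (c : ram_program) : Prop :=
  forall i ins, onth c i = Some ins -> onth P (b + i) = Some ins.

Lemma size_compile d b c : size (compile d b c) = csize c.
Proof.
elim: c d b => //= [c1 IH1 c2 IH2|x c1 IH|x c1 IH] d b.
- by rewrite size_cat IH1 IH2.
- by rewrite IH.
- by rewrite size_cat IH /= !addnS addn0.
Qed.

Lemma code_at_cat P b c1 c2 : code_at P b (c1 ++ c2) ->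
  code_at P b c1 /\ code_at P (b + size c1) c2.
Proof.
move=> H; split=> i ins E.
  apply: H; rewrite onth_cat; case: ltnP => // si.
  by rewrite onth_default in E.
rewrite -addnA; apply: H; rewrite onth_cat.
by rewrite ltnNge leq_addr /= addKn.
Qed.

Lemma code_at_cons P b i c : code_at P b (i :: c) ->
  onth P b = Some i /\ code_at P b.+1 c.
Proof.
move=> H; split; first by rewrite -[b]addn0; exact: H.
by move=> j ins E; rewrite addSnnS; apply: H.
Qed.

Lemma step_at P m ins : onth P (pc m) = Some ins -> step P m = exec ins m.
Proof. by rewrite /step => ->. Qed.

(** [represents] says nothing of the registers between scalars and heap, so the survival of the
    enclosing counters has to be carried separately. *)
Definition keeps_counters (d : nat) (m m' : ram_state) : Prop :=
  forall j, j < d -> reg m' (counter j) = reg m (counter j).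

Definition simulates P d b len t (m : ram_state) (s' : cstate) : Prop :=
  let m' := iter t (step P) m in
  [/\ pc m' = b + len, represents s' m' & keeps_counters d m m'].

Lemma sim_step P ins d b m s' : onth P b = Some ins -> pc m = b ->
  pc (exec ins m) = b + 1 -> represents s' (exec ins m) ->
  keeps_counters d m (exec ins m) -> simulates P d b 1 1 m s'.
Proof. by move=> Pb pcm E1 E2 E3; rewrite /simulates /= (@step_at _ _ ins) ?pcm. Qed.

Lemma sim_trans P d b len1 len2 t1 t2 m s1 s2 :
  simulates P d b len1 t1 m s1 ->
  (forall m', pc m' = b + len1 -> represents s1 m' ->
     simulates P d (b + len1) len2 t2 m' s2) ->
  simulates P d b (len1 + len2) (t1 + t2) m s2.
Proof.
move=> [pc1 rep1 keep1] /(_ _ pc1 rep1) [pc2 rep2 keep2].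
rewrite /simulates addnC iterD; split=> //; first by rewrite pc2 addnA.
by move=> j jd; rewrite keep2 // keep1.
Qed.

Ltac reg_arith := unfold scratch, counter, heap_base in *; lia.

Lemma represents_set s m x v : x < scratch -> represents s m ->
  represents (set_sc s x v) (set_reg m x v).
Proof.
move=> xs [rs rh ri ro]; split=> //= [y ys|p].
  by case: eqP => // _; exact: rs.
by rewrite gtn_eqF ?rh //; reg_arith.
Qed.

Lemma represents_set_counter s m x v : scratch <= x < heap_base -> represents s m ->
  represents s (set_reg m x v).
Proof.
move=> xs [rs rh ri ro]; split=> //= [y ys|p].
  by rewrite ltn_eqF ?rs //; reg_arith.
by rewrite gtn_eqF ?rh //; reg_arith.
Qed.

Lemma keeps_set d m x v : x <= scratch -> keeps_counters d m (set_reg m x v).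
Proof. by move=> xs j jd /=; rewrite gtn_eqF //; reg_arith. Qed.

(** The code sits at any offset of any program, so that the induction applies to subcommands; a loop
    needs a further induction on the rounds left. *)
Lemma compile_correct P c d b m s : wf d c -> code_at P b (compile d b c) ->
  pc m = b -> represents s m ->
  simulates P d b (csize c) (ctime c s) m (den c s).
Proof.
elim: c d b m s => [x k|x y z|x y z|x y|x y|x|x|c1 IH1 c2 IH2|x c1 IH|x c1 IH]
  d b m s /= wfc code pcm rep.
- have [Pb _] := code_at_cons code.
  apply: (sim_step Pb) => //=; first by rewrite pcm addn1.
    exact: represents_set.
  by apply: keeps_set; apply: ltnW.
- have [Pb _] := code_at_cons code; case/and3P: wfc => xs ys zs.
  have [rs _ _ _] := rep.
  apply: (sim_step Pb) => //=; first by rewrite pcm addn1.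
    by rewrite -!rs //; exact: represents_set.
  by apply: keeps_set; apply: ltnW.
- have [Pb _] := code_at_cons code; case/and3P: wfc => xs ys zs.
  have [rs _ _ _] := rep.
  apply: (sim_step Pb) => //=; first by rewrite pcm addn1.
    by rewrite -!rs //; exact: represents_set.
  by apply: keeps_set; apply: ltnW.
- have [P0 /code_at_cons [P1 /code_at_cons [P2 _]]] := code_at_cons code.
  case/andP: wfc => xs ys; have [rs rh ri ro] := rep.
  rewrite /simulates iterSr (step_at (ins := Const scratch heap_base)) ?pcm //.
  rewrite iterSr (step_at (ins := Add scratch scratch y)) /= ?pcm //.
  rewrite (step_at (ins := LoadAt x scratch)) /= ?pcm //.
  have ysc : (y == scratch) = false by apply: ltn_eqF.
  split; first by rewrite addn3.
    rewrite ysc rs // rh; apply: represents_set => //.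
    by do 2! apply: represents_set_counter => //.
  by move=> j jd /=; rewrite !gtn_eqF //; reg_arith.
- have [P0 /code_at_cons [P1 /code_at_cons [P2 _]]] := code_at_cons code.
  case/and3P: wfc => xs ys ds; have [rs rh ri ro] := rep.
  rewrite /simulates iterSr (step_at (ins := Const scratch heap_base)) ?pcm //.
  rewrite iterSr (step_at (ins := Add scratch scratch x)) /= ?pcm //.
  rewrite (step_at (ins := StoreAt scratch y)) /= ?pcm //.
  have xsc : (x == scratch) = false by apply: ltn_eqF.
  have ysc : (y == scratch) = false by apply: ltn_eqF.
  split; first by rewrite addn3.
    rewrite xsc ysc !rs //; split=> //= [z zs|p].
      by rewrite !ltn_eqF ?rs //; reg_arith.
    by rewrite eqn_add2l; case: eqP => // _; rewrite !gtn_eqF ?rh //; reg_arith.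
  move=> j jd /=; rewrite xsc ltn_eqF ?gtn_eqF //; reg_arith.
- have [Pb _] := code_at_cons code; have [rs rh ri ro] := rep.
  apply: (sim_step Pb) => //=; first by rewrite pcm addn1.
    split=> //= [y ys|p|]; rewrite -?ri //.
      by case: eqP => // _; exact: rs.
    by rewrite gtn_eqF ?rh //; reg_arith.
  by move=> j jd /=; rewrite gtn_eqF //; reg_arith.
- have [Pb _] := code_at_cons code; have [rs rh ri ro] := rep.
  apply: (sim_step Pb) => //=; first by rewrite pcm addn1.
  by split=> //=; rewrite ro (rs _ wfc).
- case/andP: wfc => wf1 wf2.
  have [code1 code2] := code_at_cat code.
  apply: sim_trans; first exact: IH1.
  move=> m' pcm' rep'; apply: IH2 => //.
  by rewrite size_compile in code2.
- case/andP: wfc => xs wf1; have [rs _ _ _] := rep.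
  have [P0 code1] := code_at_cons code.
  have st : step P m = jump m (if reg m x == 0 then b + csize c1 + 1 else (pc m).+1).
    by apply: (step_at (ins := JumpZero x (b + csize c1 + 1))); rewrite pcm.
  rewrite /simulates iterSr st rs //.
  case: eqP => _ /=; first by split=> //; rewrite addn1 addnS.
  have [|pc2 rep2 keep2] := IH d b.+1 (jump m (pc m).+1) s wf1 code1 _ rep.
    by rewrite /= pcm.
  by split=> //; rewrite pc2 addSnnS.
- case/and3P: wfc => xs cd wf1; have [rs _ _ _] := rep.
  have [P0 /code_at_cons [P1 /code_at_cons [P2 /code_at_cons [P3 /code_at_cons [P4 code5]]]]] := code_at_cons code.
  rewrite (_ : b + 5 = b.+1.+4) in code5; last by lia.
  have [codeb codej] := code_at_cat code5.
  have [P6 _] := code_at_cons codej; rewrite size_compile in P6.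
  set cnt := counter d.
  (* one pass through the loop test with [k] iterations left *)
  have loop k m0 s0 : pc m0 = b.+2 -> represents s0 m0 -> reg m0 cnt = k ->
      let t := (\sum_(i < k) (4 + ctime c1 (iter i (den c1) s0))).+1 in
      let m' := iter t (step P) m0 in
      [/\ pc m' = b + (csize c1 + 6), represents (iter k (den c1) s0) m'
        & keeps_counters d m0 m'].
    elim: k m0 s0 => [|k IHk] m0 s0 pc0 rep0 cnt0 t m'.
      rewrite /m' /t big_ord0 /= (step_at (ins := JumpZero cnt (b + csize c1 + 6))) ?pc0 //.
      by rewrite /= cnt0 /=; split=> //=; rewrite addnA.
    have tE : t = (\sum_(i < k) (4 + ctime c1 (iter i (den c1) (den c1 s0)))).+1
                  + (1 + (ctime c1 s0 + 3)).
      rewrite /t big_ord_recl /=.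
      under eq_bigr do rewrite -iterS iterSr.
      by move: (\sum_(_ < k) _) => S; lia.
    have [m3 [m3E pc3 rep3 cnt3 keep3]] : exists m3, [/\ iter 3 (step P) m0 = m3,
        pc m3 = b.+1.+4, represents s0 m3, reg m3 cnt = k & keeps_counters d m0 m3].
      exists (set_reg (set_reg (jump m0 b.+3) scratch 1) cnt k); split=> //=.
      - rewrite -[LHS]/(iter 3 (step P) m0).
        rewrite iterSr (step_at (ins := JumpZero cnt (b + csize c1 + 6))) ?pc0 //.
        rewrite /exec cnt0 pc0 iterSr (step_at (ins := Const scratch 1)) //.
        rewrite iterSr (step_at (ins := Defs.Sub cnt cnt scratch)) //.
        by rewrite /= /set_reg /= cnt0 subn1.
      - by do 2! apply: represents_set_counter => //; reg_arith.
      - by rewrite eqxx.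
      - by move=> j jd /=; rewrite /cnt !ltn_eqF //; reg_arith.
    have [pc4 rep4 keep4] := IH d.+1 b.+1.+4 m3 s0 wf1 codeb pc3 rep3.
    rewrite /m' tE !iterD m3E; set m4 := iter _ _ m3 in pc4 rep4 keep4 *.
    rewrite [iter 1 _ _]/= (step_at (ins := Jump (b + 2))) ?pc4 //=.
    have [||pc5 rep5 keep5] := IHk (jump m4 (b + 2)) (den c1 s0) _ rep4.
    - by rewrite addn2.
    - by rewrite /= keep4.
    rewrite -iterSr in rep5; split=> // j jd.
    by rewrite keep5 //= keep4 1?keep3 // ltnW.
  pose m2 := set_reg (set_reg m scratch 0) cnt (sc s x).
  have m2E : iter 2 (step P) m = m2.
    rewrite iterSr (step_at (ins := Const scratch 0)) ?pcm //.
    rewrite iterSr (step_at (ins := Add cnt x scratch)) /= ?pcm //.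
    by rewrite (ltn_eqF xs) rs // addn0.
  have [|||pc7 rep7 keep7] := loop (sc s x) m2 s.
  - by rewrite /= pcm.
  - by do 2! apply: represents_set_counter => //; reg_arith.
  - by rewrite /= eqxx.
  rewrite /simulates [3 + _]addSn [2 + _]addnC -addSn iterD m2E; split=> // j jd.
  by rewrite keep7 //= !ltn_eqF //; reg_arith.
Qed.

(* Without multiplication a step lengthens the largest number by at most one
   digit, so the logarithmic cost is quadratic in the number of steps. *)
Definition mul_free (i : ram_instr) : bool := if i is Mul _ _ _ then false else true.

Definition literals (i : ram_instr) : seq nat :=
  match i with
  | Const x k => [:: x; k]
  | Add x y z | Defs.Sub x y z | Mul x y z => [:: x; y; z]
  | LoadAt x y | StoreAt x y | JumpZero x y => [:: x; y]
  | Jump x | Read x | Write x => [:: x]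
  end.

Definition short (w : nat) (s : seq nat) : bool := all (fun x => x < 2 ^ w) s.

Definition light (w : nat) (P : ram_program) : bool :=
  all (fun i => mul_free i && short w (literals i)) P.

Lemma bitlen_le w m : 0 < w -> m < 2 ^ w -> bitlen m <= w.
Proof.
move=> w0 mw; rewrite /bitlen; have [->|m0] := posnP m; first by rewrite trunc_log0.
by rewrite -(ltn_exp2l _ _ (isT : 1 < 2)) (leq_ltn_trans _ mw) // trunc_logP.
Qed.

Lemma light_onth w P k i : light w P -> onth P k = Some i ->
  mul_free i /\ short w (literals i).
Proof.
move=> lP Pk; have [kP|kP] := ltnP k (size P); last by rewrite onth_default in Pk.
have /(all_nthP i)/(_ k kP) := lP.
by rewrite (@onth_nth _ i i P k Pk) => /andP[].
Qed.

Lemma light_step w t P m : 0 < w -> light w P ->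
  (forall x, reg m x < 2 ^ (w + t)) -> short w (inp m) ->
  [/\ step_cost P m <= 5 * (w + t),
      forall x, reg (step P m) x < 2 ^ (w + t.+1)
    & short w (inp (step P m))].
Proof.
move=> w0 lP rm im; have w2 : 2 ^ w <= 2 ^ (w + t) by rewrite leq_exp2l ?leq_addr.
have S2 : 2 ^ (w + t.+1) = 2 ^ (w + t) + 2 ^ (w + t).
  by rewrite addnS expnS mul2n addnn.
have bit x : x < 2 ^ (w + t) -> bitlen x <= w + t by apply: bitlen_le; lia.
have litb x : x < 2 ^ w -> bitlen x <= w + t by move=> xw; apply: bit; lia.
have rb x : bitlen (reg m x) <= w + t by exact: bit.
have hd : head 0 (inp m) < 2 ^ w.
  by case: (inp m) im => [|z l] /=; [rewrite expn_gt0 | case/andP].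
rewrite /step /step_cost; case Pm: (onth P (pc m)) => [i|]; last first.
  by split=> // x; apply: leq_trans (rm x) _; lia.
have [mi li] := light_onth lP Pm.
have setb v x z : v < 2 ^ (w + t.+1) -> [eta reg m with x |-> v] z < 2 ^ (w + t.+1).
  by move=> vb /=; case: eqP => // _; apply: leq_trans (rm z) _; lia.
have bits x1 x2 x3 x4 x5 : x1 <= w + t -> x2 <= w + t -> x3 <= w + t ->
  x4 <= w + t -> x5 <= w + t -> x1 + x2 + x3 + x4 + x5 <= 5 * (w + t) by lia.
case: i mi li {Pm} => [x k|x y z|x y z|x y z|x y|x y|x|x l|x|x] //= _;
  rewrite /short /= ?andbT.
- case/andP=> xw kw; split=> //; first by have := litb _ xw; have := litb _ kw; lia.
  by move=> v; apply: setb; lia.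
- case/and3P=> xw yw zw; split=> //; first by apply: bits; auto.
  by move=> v; apply: setb; rewrite S2; have := rm y; have := rm z; lia.
- case/and3P=> xw yw zw; split=> //; first by apply: bits; auto.
  by move=> v; apply: setb; have := rm y; lia.
- case/andP=> xw yw; split=> //.
    by have := litb _ xw; have := litb _ yw; have := rb y; have := rb (reg m y); lia.
  by move=> v; apply: setb; have := rm (reg m y); lia.
- case/andP=> xw yw; split=> //.
    by have := litb _ xw; have := litb _ yw; have := rb y; have := rb x; lia.
  by move=> v; apply: setb; have := rm y; lia.
- move=> xw; split=> //; first by have := litb _ xw; lia.
  by move=> v; apply: leq_trans (rm v) _; lia.
- case/andP=> xw lw; split=> //.
    by have := litb _ xw; have := litb _ lw; have := rb x; lia.
  by move=> v; apply: leq_trans (rm v) _; lia.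
- move=> xw; split=> //.
  + by have := litb _ xw; have := litb _ hd; lia.
  + by move=> v; apply: setb; lia.
  + by case: (inp m) im => //= ? ? /andP[].
- move=> xw; split=> //; first by have := litb _ xw; have := rb x; lia.
  by move=> v; apply: leq_trans (rm v) _; lia.
Qed.

Lemma light_run_cost w P input T : 0 < w -> light w P -> short w input ->
  \sum_(s < T) step_cost P (run P input s) <= T * (5 * (w + T)).
Proof.
move=> w0 lP si.
have inv t : (forall x, reg (run P input t) x < 2 ^ (w + t)) /\
             short w (inp (run P input t)).
  elim: t => [|t [IHr IHi]]; first by split=> // x; rewrite /= expn_gt0.
  by have [_ ? ?] := light_step w0 lP IHr IHi.
rewrite -[T in leqRHS]card_ord -sum_nat_const; apply: leq_sum => s _.
have [IHr IHi] := inv s.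
have [c _ _] := light_step w0 lP IHr IHi.
by apply: leq_trans c _; rewrite leq_pmul2l // leq_add2l ?card_ord ltnW.
Qed.

Fixpoint lit_bound (i : seq ram_instr) : nat :=
  if i is i1 :: i2 then maxn (sumn (literals i1)) (lit_bound i2) else 0.

Lemma lightP P : all mul_free P -> exists w0, forall w, w0 <= w -> light w P.
Proof.
move=> mP; exists (lit_bound P) => w; elim: P mP => //= i P IH /andP[mi mP].
rewrite geq_max => /andP[iw Pw]; rewrite mi IH //= andbT.
have {iw} : sumn (literals i) < 2 ^ w by apply: leq_ltn_trans iw _; exact: ltn_expl.
rewrite /short; elim: (literals i) => //= x l IHl xl.
by rewrite IHl; [rewrite andbT; lia | lia].
Qed.

Lemma compile_mul_free d b c : all mul_free (compile d b c).
Proof.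
elim: c d b => //= [c1 IH1 c2 IH2|x c1 IH] d b; rewrite all_cat ?IH1 //=.
by rewrite IH.
Qed.

Definition cinit (input : seq nat) : cstate :=
  CState (fun=> 0) (fun=> 0) input [::].

Lemma compiled_outputs c : wf 0 c -> exists w0, forall w input T,
  w0 <= w -> short w input -> ctime c (cinit input) <= T ->
  outputs_in_time (compile 0 0 c) input (cout (den c (cinit input)))
    (T * (5 * (w + T))).
Proof.
move=> wfc; have [w0 lw] := lightP (compile_mul_free 0 0 c).
exists w0.+1 => w input T ww si tT.
have [|//||pcE [_ _ _ outE] _] := @compile_correct (compile 0 0 c) c 0 0
   (ram_init input) (cinit input) wfc.
- by move=> i ins; rewrite add0n.
- by split.
exists (ctime c (cinit input)); split=> //.
  by rewrite /halted /run pcE size_compile add0n.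
apply: leq_trans (@light_run_cost w _ _ _ _ _ si) _; first by lia.
  by apply: lw; lia.
by rewrite leq_mul // leq_mul // leq_add2l.
Qed.

(* Loops whose iteration counts sit in the registers 0 and 1, which the body
   never writes, run in polynomial time. *)
Fixpoint frozen (c : cmd) : bool :=
  match c with
  | CConst x _ | CAdd x _ _ | CSub x _ _ | CLoad x _ | CRead x => 1 < x
  | CStore _ _ | CWrite _ => true
  | CSeq c1 c2 => frozen c1 && frozen c2
  | CIf _ c1 => frozen c1
  | CLoop x c1 => (x <= 1) && frozen c1
  end.

Fixpoint time_bound (c : cmd) (M : nat) : nat :=
  match c with
  | CLoad _ _ | CStore _ _ => 3
  | CSeq c1 c2 => time_bound c1 M + time_bound c2 M
  | CIf _ c1 => (time_bound c1 M).+1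
  | CLoop _ c1 => 3 + M * (4 + time_bound c1 M)
  | _ => 1
  end.

Lemma frozen_den c s x : frozen c -> x <= 1 -> sc (den c s) x = sc s x.
Proof.
move=> + x1; elim: c s => [y k|y u v|y u v|y u|y u|y|y|c1 IH1 c2 IH2|y c1 IH|y c1 IH] s //=;
  try by move=> y1; rewrite ltn_eqF // (leq_ltn_trans x1).
- by case/andP=> f1 f2; rewrite IH2 // IH1.
- by move=> f1; case: ifP => // _; exact: IH.
- case/andP=> _ f1; elim: (sc s y) => //= k IHk.
  by rewrite IH.
Qed.

Lemma ctime_le c s M : frozen c -> sc s 0 <= M -> sc s 1 <= M ->
  ctime c s <= time_bound c M.
Proof.
elim: c s => [y k|y u v|y u v|y u|y u|y|y|c1 IH1 c2 IH2|y c1 IH|y c1 IH] s //=.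
- case/andP=> f1 f2 s0 s1; rewrite leq_add ?IH1 ?IH2 ?frozen_den //.
- by move=> f1 s0 s1; rewrite ltnS; case: ifP => // _; exact: IH.
- case/andP=> y1 f1 s0 s1; rewrite leq_add2l.
  have yM : sc s y <= M by case: y y1 => [|[|]].
  apply: (@leq_trans (\sum_(k < sc s y) (4 + time_bound c1 M))).
    apply: leq_sum => k _; rewrite leq_add2l; apply: IH => //.
      by elim: (nat_of_ord k) => //= j; rewrite frozen_den.
    by elim: (nat_of_ord k) => //= j; rewrite frozen_den.
  by rewrite sum_nat_const card_ord leq_mul2r yM orbT.
Qed.

(** Only existence matters: sequencing adds exponents, a loop raises the exponent by one, and
    neither constant is ever evaluated. *)
Lemma time_bound_poly c : exists K D, forall M, time_bound c M <= K * M.+1 ^ D.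
Proof.
have one D M : 0 < M.+1 ^ D by rewrite expn_gt0.
have up D1 D2 M : D1 <= D2 -> M.+1 ^ D1 <= M.+1 ^ D2 by apply: leq_pexp2l.
elim: c => [y k|y u v|y u v|y u|y u|y|y|c1 [K1 [D1 H1]] c2 [K2 [D2 H2]]
           |y c1 [K [D H]]|y c1 [K [D H]]] /=;
  try by exists 3, 0 => M; rewrite expn0.
- exists (K1 + K2), (D1 + D2) => M; rewrite mulnDl; apply: leq_add.
    by apply: leq_trans (H1 M) _; rewrite leq_mul2l up ?leq_addr ?orbT.
  by apply: leq_trans (H2 M) _; rewrite leq_mul2l up ?leq_addl ?orbT.
- exists K.+1, D => M; rewrite mulSn addnC -addn1; exact: leq_add.
- exists (7 + K), D.+1 => M; rewrite expnS.
  have := H M; have := one D M; move: (M.+1 ^ D) (time_bound c1 M) => E t E0 tE.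
  have : M * (4 + t) <= M * (4 * E + K * E) by rewrite leq_mul2l; apply/orP; right; lia.
  rewrite -mulnDl mulSn => B; apply: leq_trans (leq_add (leqnn 3) B) _.
  nia.
Qed.

(** * The search program *)

Fixpoint writes (c : cmd) : seq nat :=
  match c with
  | CConst x _ | CAdd x _ _ | CSub x _ _ | CLoad x _ | CRead x => [:: x]
  | CStore _ _ | CWrite _ => [::]
  | CSeq c1 c2 => writes c1 ++ writes c2
  | CIf _ c1 | CLoop _ c1 => writes c1
  end.

Fixpoint silent (c : cmd) : bool :=
  match c with
  | CRead _ | CWrite _ => false
  | CSeq c1 c2 => silent c1 && silent c2
  | CIf _ c1 | CLoop _ c1 => silent c1
  | _ => true
  end.

Lemma sc_den c s x : x \notin writes c -> sc (den c s) x = sc s x.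
Proof.
elim: c s => [y k|y u v|y u v|y u|y u|y|y|c1 IH1 c2 IH2|y c1 IH|y c1 IH] s //=;
  try by rewrite inE => /negbTE ->.
- by rewrite mem_cat negb_or => /andP[x1 x2]; rewrite IH2 // IH1.
- by move=> x1; case: ifP => // _; exact: IH.
- by move=> x1; elim: (sc s y) => //= k IHk; rewrite IH.
Qed.

Lemma den_seq c1 c2 s : den (CSeq c1 c2) s = den c2 (den c1 s).
Proof. by []. Qed.

Lemma den_if x c s : den (CIf x c) s = if sc s x == 0 then s else den c s.
Proof. by []. Qed.

Lemma io_den c s : silent c ->
  cinp (den c s) = cinp s /\ cout (den c s) = cout s.
Proof.
elim: c s => [y k|y u v|y u v|y u|y u|y|y|c1 IH1 c2 IH2|y c1 IH|y c1 IH] s //=.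
- case/andP=> s1 s2; have [-> ->] := IH2 (den c1 s) s2; exact: IH1.
- by move=> s1; case: ifP => // _; exact: IH.
- move=> s1; elim: (sc s y) => //= k [<- <-]; exact: IH.
Qed.

(** The invariant may ignore the scalars that the body never writes: their preservation is supplied
    at each round. *)
Lemma loop_rule m x c s (I : nat -> cstate -> Prop) : sc s x = m -> I 0 s ->
  (forall k y, k < m -> (forall z, z \notin writes c -> sc y z = sc s z) ->
     I k y -> I k.+1 (den c y)) ->
  I m (den (CLoop x c) s).
Proof.
move=> sm I0 IS /=; rewrite sm.
have [] // : (forall z, z \notin writes c ->
    sc (iter m (den c) s) z = sc s z) /\ I m (iter m (den c) s).
elim: {-2}m (leqnn m) => [//|k IHk] ks.
have [sk Ik] := IHk (ltnW ks); split=> [z zc|]; last exact: IS.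
by rewrite /= sc_den // sk.
Qed.

Local Notation "c1 ;; c2" := (CSeq c1 c2) (at level 61, right associativity).
(* [rB] is the base of the vectors, which follow the adjacency matrix in the
   heap; the current vector starts at [rZ], the next one at [rW]; [rQ], [rR]
   and [rP] run through vectors and matrix.  Pairs such as [rx] and [ry] hold
   the positive and negative parts of an integer. *)
Local Notation rn := 0.
Local Notation rN := 1.
Local Notation one := 2.
Local Notation zero := 3.
Local Notation rB := 4.
Local Notation rr := 5.
Local Notation rh := 6.
Local Notation ra := 7.
Local Notation rb := 8.
Local Notation rsg := 9.
Local Notation rc := 10.
Local Notation rfail := 11.
Local Notation rres := 12.
Local Notation rZ := 13.
Local Notation rW := 14.
Local Notation rth := 15.
Local Notation rQ := 16.
Local Notation rR := 17.
Local Notation rP := 18.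
Local Notation rx := 19.
Local Notation ry := 20.
Local Notation rax := 21.
Local Notation ray := 22.
Local Notation rxj := 23.
Local Notation ryj := 24.
Local Notation rv := 25.
Local Notation rt := 26.

Definition incr x := CAdd x x one.

(** For an edge it adds v_i - v_j to the accumulator, crossing positive and negative parts so that
    no subtraction occurs. *)
Definition row_body : cmd :=
  CLoad rv rP ;; incr rP ;; CLoad rxj rR ;; incr rR ;; CLoad ryj rR ;; incr rR ;;
  CIf rv (CAdd rax rax rx ;; CAdd rax rax ryj ;; CAdd ray ray ry ;; CAdd ray ray rxj).
Definition row_loop : cmd := CLoop rn row_body.

(** Subtracts th v_i by repeated addition. The enclosing loop has a fixed count, so [rt] counts down
    and the remaining rounds are idle. *)
Definition shift_body : cmd :=
  CIf rt (CAdd rax rax ry ;; CAdd ray ray rx ;; CSub rt rt one).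
Definition shift_loop : cmd := CLoop rN shift_body.

Definition entry_load : cmd :=
  CLoad rx rQ ;; incr rQ ;; CLoad ry rQ ;; incr rQ ;;
  CAdd rax zero zero ;; CAdd ray zero zero ;; CAdd rR rZ zero.
Definition entry_store : cmd :=
  CStore rW rax ;; incr rW ;; CStore rW ray ;; incr rW.
Definition entry_body : cmd :=
  entry_load ;; row_loop ;; CAdd rt rth zero ;; shift_loop ;; entry_store.
Definition entry_loop : cmd := CLoop rn entry_body.

(** After the loop [rQ] has run through the old vector and points just past it, where the new one
    was written; setting [rZ] to it replaces any copying. *)
Definition apply_cmd : cmd :=
  CAdd rQ rZ zero ;; CAdd rP zero zero ;; entry_loop ;; CAdd rZ rQ zero.

Definition zero_body : cmd := CStore rW zero ;; incr rW ;; CStore rW zero ;; incr rW.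
Definition zero_loop : cmd := CLoop rn zero_body.
(** The sign flag [rsg] is an address offset: it puts the unit of entry b in the positive or in the
    negative cell. *)
Definition unit_cmd : cmd :=
  CAdd rt rB ra ;; CAdd rt rt ra ;; CStore rt one ;;
  CAdd rt rB rb ;; CAdd rt rt rb ;; CAdd rt rt rsg ;; CStore rt one ;;
  CAdd rth zero zero.
Definition init_cmd : cmd :=
  (CAdd rZ rB zero ;; CAdd rW rB zero) ;; zero_loop ;; unit_cmd.

(* The counter [rc] vanishes exactly when [rth] is in the residue class. *)
Definition sieve_body : cmd :=
  CSub rt one rc ;; CIf rt (apply_cmd ;; CAdd rc rh zero) ;;
  CSub rc rc one ;; incr rth.
Definition sieve_loop : cmd := CLoop rN sieve_body.

(** The two truncated differences add up to an absolute value, so [rfail] stays 0 only if all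
    entries vanish. *)
Definition nonzero_body : cmd :=
  CLoad rx rQ ;; incr rQ ;; CLoad ry rQ ;; incr rQ ;;
  CSub rt rx ry ;; CAdd rfail rfail rt ;; CSub rt ry rx ;; CAdd rfail rfail rt.
Definition nonzero_loop : cmd := CLoop rn nonzero_body.

Definition check_cmd : cmd :=
  init_cmd ;; sieve_loop ;; CAdd rQ rZ zero ;; nonzero_loop.

(** [rfail] accumulates over both checks, and [one - rfail] is its truncated negation. Adding the
    truncated [rh - rres] to [rres] takes the maximum. *)
Definition test_cmd : cmd :=
  (CAdd rfail zero zero ;; CAdd rsg zero zero ;; CAdd rc zero zero) ;; check_cmd ;;
  (CAdd rsg one zero ;; CAdd rc rr zero) ;; check_cmd ;;
  CSub rt one rfail ;; CIf rt (CSub rt rh rres ;; CAdd rres rres rt).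

Definition pair_cmd : cmd := CSub rt ra rb ;; CIf rt test_cmd ;; incr rb.
Definition b_loop : cmd := CLoop rn pair_cmd.
Definition a_body : cmd := CAdd rb zero zero ;; b_loop ;; incr ra.
Definition a_loop : cmd := CLoop rn a_body.
Definition h_body : cmd := (incr rh ;; CAdd ra zero zero) ;; a_loop.
Definition h_loop : cmd := CLoop rN h_body.
Definition r_body : cmd := (incr rr ;; CAdd rh rr zero) ;; h_loop.
Definition r_loop : cmd := CLoop rN r_body.

Definition start_cmd : cmd :=
  CRead rn ;; CConst one 1 ;; CAdd rN rn one ;; CAdd rN rN rN.
Definition read_body : cmd := CRead rt ;; CStore rP rt ;; incr rP.
Definition read_row : cmd := CLoop rn read_body.
Definition read_loop : cmd := CLoop rn read_row.
(** [rx], [ry] and [rt] are mutually exclusive flags for the three outputs, obtained by truncated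
    subtraction; [rxj] holds the number 2. *)
Definition answer_cmd : cmd :=
  (CSub rx one rres ;; CSub ry rres rN ;; CAdd rt rx ry ;; CSub rt one rt ;;
   CAdd rxj one one) ;;
  CIf rx (CWrite zero) ;; CIf ry (CWrite rxj) ;;
  CIf rt (CWrite one ;; CWrite one ;; CWrite rres).
Definition search_cmd : cmd :=
  read_loop ;; CAdd rB rP zero ;; r_loop ;; answer_cmd.
Definition revival_cmd : cmd := start_cmd ;; search_cmd.

Arguments row_loop : simpl never.
Arguments shift_loop : simpl never.
Arguments entry_loop : simpl never.
Arguments apply_cmd : simpl never.
Arguments zero_loop : simpl never.
Arguments sieve_loop : simpl never.
Arguments nonzero_loop : simpl never.
Arguments check_cmd : simpl never.
Arguments test_cmd : simpl never.
Arguments b_loop : simpl never.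
Arguments a_loop : simpl never.
Arguments h_loop : simpl never.
Arguments r_loop : simpl never.
Arguments read_row : simpl never.
Arguments read_loop : simpl never.
Arguments search_cmd : simpl never.

(** * Specifications of the commands of the search *)

Section Semantics.
Variables (n : nat) (A : nat -> nat -> bool).
Local Notation N := (2 * n + 2).
Implicit Types (s y : cstate) (v : nat -> int).

Record env s : Prop := Env {
  env_n : sc s rn = n;
  env_N : sc s rN = N;
  env_one : sc s one = 1;
  env_zero : sc s zero = 0;
  env_B : sc s rB = n * n;
  env_A : forall i j, i < n -> j < n -> hp s (i * n + j) = A i j
}.

(* Entry [i] of an integer vector is the difference of the heap cells
   [Z + 2 i] and [Z + 2 i + 1]. *)
Definition stores s (Z : nat) v : Prop :=
  forall i, i < n -> ((hp s (Z + 2 * i))%:Z - (hp s (Z + 2 * i + 1))%:Z = v i)%R.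

(** (L - th) v in edge form: the diagonal entry of L is the degree, so a row of L sums v_i - v_j
    over neighbours and no degree needs computing. *)
Definition lap_shift (th : nat) v (i : nat) : int :=
  (\sum_(j < n) (A i j)%:Z * (v i - v j) - th%:Z * v i)%R.

Lemma row_loopP s v i : env s -> i < n ->
  stores s (sc s rR) v -> sc s rP = i * n ->
  ((sc s rx)%:Z - (sc s ry)%:Z = v i)%R ->
  let s' := den row_loop s in
  [/\ hp s' = hp s, sc s' rP = i * n + n &
   ((sc s' rax)%:Z - (sc s' ray)%:Z =
    (sc s rax)%:Z - (sc s ray)%:Z + \sum_(j < n) (A i j)%:Z * (v i - v j))%R].
Proof.
move=> es iN sv sP xy.
pose I k y := [/\ hp y = hp s, sc y rP = i * n + k, sc y rR = sc s rR + 2 * k &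
   ((sc y rax)%:Z - (sc y ray)%:Z =
    (sc s rax)%:Z - (sc s ray)%:Z + \sum_(j < k) (A i j)%:Z * (v i - v j))%R].
have [] : I n (den row_loop s); last by [].
apply: loop_rule (env_n es) _ _ => [|k y ks fr [h1 h2 h3 h4]].
- by split; rewrite ?sP ?muln0 ?addn0 // big_ord0 addr0.
- have hA : hp y (sc y rP) = A i k by rewrite h1 h2 env_A.
  have f1 : sc y one = 1 by rewrite fr // env_one.
  have fx : sc y rx = sc s rx by rewrite fr.
  have fy : sc y ry = sc s ry by rewrite fr.
  have vk := sv _ ks.
  rewrite /I big_ord_recr /= hA; move: (\sum_(j < k) _)%R h4 => S h4.
  by case: (A i k) => /=; split=> //=; rewrite ?f1 ?h3 ?h2 ?h1 ?fx ?fy ?mul1r ?mul0r; lia.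
Qed.

Lemma shift_loopP s (d : int) : env s -> sc s rt <= N ->
  ((sc s rx)%:Z - (sc s ry)%:Z = d)%R ->
  let s' := den shift_loop s in
  hp s' = hp s /\
   ((sc s' rax)%:Z - (sc s' ray)%:Z =
    (sc s rax)%:Z - (sc s ray)%:Z - (sc s rt)%:Z * d)%R.
Proof.
move=> es tN xy.
pose I k y := [/\ hp y = hp s, sc y rt = sc s rt - k &
   ((sc y rax)%:Z - (sc y ray)%:Z =
    (sc s rax)%:Z - (sc s ray)%:Z - (minn k (sc s rt))%:Z * d)%R].
have : I N (den shift_loop s).
  apply: loop_rule (env_N es) _ _ => [|k y ks fr [h1 h2 h3]].
    by split; rewrite ?subn0 // min0n mul0r subr0.
  have f1 : sc y one = 1 by rewrite fr // env_one.
  have fx : sc y rx = sc s rx by rewrite fr.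
  have fy : sc y ry = sc s ry by rewrite fr.
  rewrite /I /= h2; case: ifP => [/eqP kt|/eqP kt]; split=> //=.
  - by lia.
  - by rewrite h3 (_ : minn k.+1 _ = minn k (sc s rt)) //; lia.
  - by rewrite f1; lia.
  - rewrite fx fy (_ : minn k.+1 _ = (minn k (sc s rt)).+1); last by lia.
    rewrite intS mulrDl mul1r; move: (_ * d)%R h3 => S h3; lia.
move=> [h1 _ h3]; split; first exact: h1.
by rewrite h3 (_ : minn N _ = sc s rt) //; lia.
Qed.

Lemma env_frame s s' : env s -> (forall x, x < 5 -> sc s' x = sc s x) ->
  (forall p, p < n * n -> hp s' p = hp s p) -> env s'.
Proof.
move=> [e1 e2 e3 e4 e5 eA] fs fh; split; rewrite ?fs // => i j iN jN.
by rewrite fh ?eA //; nia.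
Qed.

Lemma entry_loopP s v : env s -> n * n <= sc s rZ -> sc s rW = sc s rZ + 2 * n ->
  sc s rQ = sc s rZ -> sc s rP = 0 -> sc s rth <= N -> stores s (sc s rZ) v ->
  let s' := den entry_loop s in
  [/\ forall p, p < sc s rW -> hp s' p = hp s p,
     sc s' rQ = sc s rZ + 2 * n, sc s' rW = sc s rW + 2 * n &
     stores s' (sc s rW) (lap_shift (sc s rth) v)].
Proof.
move=> es Zn WZ QZ P0 thN sv.
pose I k y := [/\ forall p, p < sc s rW -> hp y p = hp s p,
     sc y rP = k * n, sc y rQ = sc s rZ + 2 * k, sc y rW = sc s rW + 2 * k &
     forall i, i < k -> ((hp y (sc s rW + 2 * i))%:Z - (hp y (sc s rW + 2 * i + 1))%:Z
       = lap_shift (sc s rth) v i)%R].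
have [h1 _ h3 h4 h5] : I n (den entry_loop s); last first.
  by split; [exact h1 | exact h3 | exact h4 | exact h5].
apply: loop_rule (env_n es) _ _ => [|k y ks fr [h1 h2 h3 h4 h5]].
    by split=> //; rewrite ?muln0 ?addn0.
  have ey : env y.
    apply: (env_frame es) => [x x5|p pn]; last by apply: h1; lia.
    by rewrite fr //; case: x x5 => [|[|[|[|[|]]]]].
  have vy : stores y (sc s rZ) v.
    by move=> i iN; rewrite !h1 ?sv //; lia.
  rewrite /entry_body 4!den_seq.
  set y1 := den entry_load y.
  have z0 := env_zero ey; have o1 := env_one ey.
  have fZ : sc y rZ = sc s rZ by rewrite fr.
  have fth : sc y rth = sc s rth by rewrite fr.
  have hp1 : hp y1 = hp y by [].
  have e1 : env y1.
    by apply: (env_frame ey) => // x x5; case: x x5 => [|[|[|[|[|]]]]].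
  have Q1 : sc y1 rQ = sc s rZ + 2 * k.+1 by rewrite /y1 /= o1 h3; lia.
  have ax1 : sc y1 rax = 0 by rewrite /y1 /= z0.
  have ay1 : sc y1 ray = 0 by rewrite /y1 /= z0.
  have R1 : sc y1 rR = sc s rZ by rewrite /y1 /= z0 fZ addn0.
  have P1 : sc y1 rP = k * n by [].
  have W1 : sc y1 rW = sc s rW + 2 * k by [].
  have th1 : sc y1 rth = sc s rth by rewrite -fth.
  have xy1 : ((sc y1 rx)%:Z - (sc y1 ry)%:Z = v k)%R.
    by rewrite /y1 /= h3 o1 vy.
  have z1 := env_zero e1.
  (* Generalising over the state keeps only the recorded facts, so that later simplification does
     not unfold the commands behind it. *)
  move: y1 hp1 e1 Q1 ax1 ay1 R1 P1 W1 th1 xy1 z1 => y1 hp1 e1 Q1 ax1 ay1 R1 P1 W1 th1 xy1 z1.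
  have [|hp2 P2 D2] := row_loopP (v := v) e1 ks _ P1 xy1.
    by rewrite R1 /stores hp1.
  have f2 x : x \notin writes row_loop -> sc (den row_loop y1) x = sc y1 x by apply: sc_den.
  move: (den row_loop y1) hp2 P2 D2 f2 => y2 hp2 P2 D2 f2.
  set y3 := den (CAdd rt rth zero) y2.
  have e3 : env y3.
    apply: (env_frame e1) => [x x5|p pn]; last by rewrite /= hp2.
    by rewrite /y3 /=; case: x x5 => [|[|[|[|[|]]]]] //= _; rewrite f2.
  have [||hp4 D4] := shift_loopP (d := v k) e3.
  - by rewrite /y3 /= !f2 // th1 z1 addn0.
  - by rewrite /y3 /= !f2.
  have f4 x : x \notin writes shift_loop -> sc (den shift_loop y3) x = sc y3 x by apply: sc_den.
  move: (den shift_loop y3) hp4 D4 f4 => y4 hp4 D4 f4.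
  have W4 : sc y4 rW = sc s rW + 2 * k by rewrite f4 //= f2.
  have o4 : sc y4 one = 1 by rewrite f4 //= f2 // env_one.
  have hp4s : hp y4 = hp y by rewrite hp4 /= hp2 hp1.
  have D : ((sc y4 rax)%:Z - (sc y4 ray)%:Z = lap_shift (sc s rth) v k)%R.
    by rewrite D4 /= D2 ax1 ay1 !f2 // th1 z1 addn0 subrr add0r.
  rewrite /I /= o4 W4 hp4s; split.
  - by move=> p pW; rewrite !ltn_eqF ?h1 //; lia.
  - by rewrite f4 //= P2; lia.
  - by rewrite f4 //= f2.
  - by lia.
  - move=> i; rewrite ltnS leq_eqVlt => /orP[/eqP ->|ik].
      by rewrite eqxx ltn_eqF ?eqxx //; lia.
    by rewrite !ltn_eqF ?h5 //; lia.
Qed.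

Lemma applyP s v : env s -> n * n <= sc s rZ -> sc s rW = sc s rZ + 2 * n ->
  sc s rth <= N -> stores s (sc s rZ) v ->
  let s' := den apply_cmd s in
  [/\ forall p, p < n * n -> hp s' p = hp s p,
     n * n <= sc s' rZ, sc s' rW = sc s' rZ + 2 * n &
     stores s' (sc s' rZ) (lap_shift (sc s rth) v)].
Proof.
move=> es Zn WZ thN sv.
rewrite /apply_cmd 3!den_seq -(den_seq _ _ s).
set s1 := den (_ ;; _) s; have z0 := env_zero es.
have e1 : env s1.
  by apply: (env_frame es) => // x x5; case: x x5 => [|[|[|[|[|]]]]].
have [||h1 Q1 W1 v1] := @entry_loopP s1 v e1 Zn WZ _ _ thN sv.
- by rewrite /s1 /= z0 addn0.
- by rewrite /s1 /= z0.
have z1 : sc (den entry_loop s1) zero = 0 by rewrite sc_den // (env_zero e1).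
move: (den entry_loop s1) h1 Q1 W1 v1 z1 => y h1 Q1 W1 v1 z1.
have Ws : sc s1 rW = sc s rW by [].
have Zs : sc s1 rZ = sc s rZ by [].
rewrite Ws in h1 W1 v1; rewrite Zs in Q1.
rewrite /= z1 addn0 Q1 W1 WZ; split=> //.
- by move=> p pn; apply: h1; lia.
- by lia.
- by rewrite -WZ.
Qed.

Definition sieve_stepv (h c : nat) v (th : nat) : nat -> int :=
  if th == c %[mod h] then lap_shift th v else v.

Definition sievev (M h c : nat) v : nat -> int :=
  foldl (sieve_stepv h c) v (iota 0 M).

Lemma sieve_loopP s v : env s -> n * n <= sc s rZ -> sc s rW = sc s rZ + 2 * n ->
  sc s rth = 0 -> sc s rc < sc s rh -> stores s (sc s rZ) v ->
  let s' := den sieve_loop s in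
  (forall p, p < n * n -> hp s' p = hp s p) /\
  stores s' (sc s' rZ) (sievev N (sc s rh) (sc s rc) v).
Proof.
move=> es Zn WZ th0 ch sv.
(* The heart is [k + rc = c] modulo [h] with [rc < h]: it makes [rc] vanish exactly when k lies in
   the class of c. *)
pose I k y := [/\ forall p, p < n * n -> hp y p = hp s p,
  (n * n <= sc y rZ) && (sc y rW == sc y rZ + 2 * n), sc y rth = k,
  (sc y rc < sc s rh) && (k + sc y rc == sc s rc %[mod sc s rh]) &
  stores y (sc y rZ) (sievev k (sc s rh) (sc s rc) v)].
have [h1 _ _ _ h5] : I N (den sieve_loop s); last by split; [exact h1 | exact h5].
apply: loop_rule (env_N es) _ _ => [|k y ks fr [h1 /andP[h2 /eqP h3] h4 /andP[h5 /eqP h6] h7]].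
  by split=> //; rewrite ?WZ ?Zn ?ch ?eqxx.
have ey : env y.
  apply: (env_frame es) => [x x5|p pn]; last exact: h1.
  by rewrite fr //; case: x x5 => [|[|[|[|[|]]]]].
have o1 := env_one ey; have z0 := env_zero ey.
have fh : sc y rh = sc s rh by rewrite fr.
have svS : sievev k.+1 (sc s rh) (sc s rc) v =
  sieve_stepv (sc s rh) (sc s rc) (sievev k (sc s rh) (sc s rc) v) k.
  by rewrite /sievev -[X in iota 0 X]addn1 iotaD foldl_cat /= add0n.
rewrite /I svS; move: (sievev k _ _ v) h7 {svS} => w h7.
rewrite /sieve_body 2!den_seq; set y1 := den (CSub rt one rc) y.
have t1 : sc y1 rt = 1 - sc y rc by rewrite /y1 /= o1.
rewrite den_if t1.
rewrite /sieve_stepv; have [c0|c0] := posnP (sc y rc).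
  have -> : (k == sc s rc %[mod sc s rh]) by rewrite -h6 c0 addn0.
  have -> : (1 - sc y rc == 0) = false by lia.
  rewrite (den_seq apply_cmd).
  have e1 : env y1.
    by apply: (env_frame ey) => // x x5; case: x x5 => [|[|[|[|[|]]]]].
  have [|g1 g2 g3 g4] := @applyP y1 w e1 h2 h3 _ h7.
    by rewrite /y1 /= h4; lia.
  have f2 x : x \notin writes apply_cmd -> sc (den apply_cmd y1) x = sc y1 x by apply: sc_den.
  move: (den apply_cmd y1) g1 g2 g3 g4 f2 => y2 g1 g2 g3 g4 f2.
  have o2 : sc y2 one = 1 by rewrite f2.
  have z2 : sc y2 zero = 0 by rewrite f2.
  have h2' : sc y2 rh = sc s rh by rewrite f2 // -fh.
  have th2 : sc y2 rth = k by rewrite f2 // -h4.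
  rewrite /= o2 z2 addn0 h2' th2; split.
  - by move=> p pn; rewrite g1 // h1.
  - by rewrite g2 g3 eqxx.
  - by rewrite addn1.
  - rewrite -h6 c0 addn0 (_ : k.+1 + _ = k + sc s rh); last by lia.
    by rewrite modnDr eqxx andbT; lia.
  - by rewrite -[k]h4.
have -> : (k == sc s rc %[mod sc s rh]) = false.
  apply/negP; rewrite -h6 -{1}[k]addn0 eqn_modDl mod0n modn_small //.
  by rewrite eq_sym; lia.
have -> : (1 - sc y rc == 0) by lia.
rewrite /= o1 h4; split=> //.
- by rewrite h2 h3 eqxx.
- by rewrite addn1.
- by rewrite -h6 (_ : k.+1 + _ = k + sc y rc) ?eqxx ?andbT; lia.
Qed.

Lemma nonzero_loopP s v : env s -> stores s (sc s rQ) v ->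
  let s' := den nonzero_loop s in
  hp s' = hp s /\
  (sc s' rfail = 0 <-> sc s rfail = 0 /\ forall i, i < n -> v i = 0%R).
Proof.
move=> es sv.
pose I k y := [/\ hp y = hp s, sc y rQ = sc s rQ + 2 * k &
  (sc y rfail = 0 <-> sc s rfail = 0 /\ forall i, i < k -> v i = 0%R)].
have [h1 _ h3] : I n (den nonzero_loop s); last by split; [exact h1 | exact h3].
apply: loop_rule (env_n es) _ _ => [|k y ks fr [h1 h2 h3]].
  by split=> //; rewrite ?addn0 //; split=> // -[].
have vk := sv _ ks.
have o1 : sc y one = 1 by rewrite fr // env_one.
rewrite /I /= o1 h1 h2; split=> //; first by lia.
split=> [E|[s0 all0]].
  have [|s0 all0] := h3.1; first by lia.
  split=> // i; rewrite ltnS leq_eqVlt => /orP[/eqP ->|]; last exact: all0.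
  by lia.
have v0 := all0 k (ltnSn k).
have y0 : sc y rfail = 0 by apply: h3.2; split=> // i ik; apply: all0; lia.
by lia.
Qed.

Definition initv (sg a b i : nat) : int :=
  ((i == a)%:Z + (if sg == 0%N then 1 else - 1) * (i == b)%:Z)%R.

Lemma init_cmdP s : env s -> sc s ra < n -> sc s rb < sc s ra -> sc s rsg <= 1 ->
  let s' := den init_cmd s in
  [/\ forall p, p < n * n -> hp s' p = hp s p, sc s' rZ = n * n,
     sc s' rW = n * n + 2 * n, sc s' rth = 0 &
     stores s' (n * n) (initv (sc s rsg) (sc s ra) (sc s rb))].
Proof.
move=> es an bn sg1.
rewrite /init_cmd 2!den_seq.
set s1 := den (_ ;; _) s; have z0 := env_zero es; have B0 := env_B es.
have e1 : env s1.
  by apply: (env_frame es) => // x x5; case: x x5 => [|[|[|[|[|]]]]].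
have W1 : sc s1 rW = n * n by rewrite /s1 /= B0 z0 addn0.
have Z1 : sc s1 rZ = n * n by rewrite /s1 /= B0 z0 addn0.
pose I k y := [/\ forall p, p < n * n -> hp y p = hp s p,
   sc y rW = n * n + 2 * k & forall i, i < 2 * k -> hp y (n * n + i) = 0].
have : I n (den zero_loop s1).
  apply: loop_rule (env_n es : sc s1 rn = n) _ _ => [|k y ks fr [h1 h2 h3]].
    by split=> //; rewrite W1 addn0.
  have o1 : sc y one = 1 by rewrite fr // (env_one e1).
  have zz : sc y zero = 0 by rewrite fr // (env_zero e1).
  rewrite /I /= o1 h2 zz; split=> [p pn||i ik]; last 1 first.
  - case: eqP => // ne1; case: eqP => // ne2; apply: h3; lia.
  - by rewrite !ltn_eqF ?h1 //; lia.
  - by lia.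
have f2 x : x \notin writes zero_loop -> sc (den zero_loop s1) x = sc s1 x by apply: sc_den.
move: (den zero_loop s1) f2 => y f2 [h1 h2 h3].
have By : sc y rB = n * n by rewrite f2.
have ay : sc y ra = sc s ra by rewrite f2.
have yb : sc y rb = sc s rb by rewrite f2.
have oy : sc y one = 1 by rewrite f2 // (env_one e1).
have zy : sc y zero = 0 by rewrite f2 // (env_zero e1).
have sy : sc y rsg = sc s rsg by rewrite f2.
rewrite /= By ay yb oy zy sy; split=> //.
- by move=> p pn; rewrite !ltn_eqF ?h1 //; lia.
- by rewrite f2.
- have hy p : n * n <= p < n * n + 2 * n -> hp y p = 0.
    by move=> pn; rewrite -(subnKC (proj1 (andP pn))) h3 //; lia.
  move=> i iN /=; rewrite /initv !hy; try lia.
  have [|sg0] : sc s rsg = 0 \/ sc s rsg = 1 by lia.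
    move=> ->; do ?case: eqP => ? //=; lia.
  by rewrite sg0; do ?case: eqP => ? //=; lia.
Qed.

Lemma env_den c s : env s -> all (fun x => x \notin writes c) (iota 0 5) ->
  (forall p, p < n * n -> hp (den c s) p = hp s p) -> env (den c s).
Proof.
move=> es /allP wc hc; apply: (env_frame es) => // x x5.
by apply: sc_den; apply: wc; rewrite mem_iota.
Qed.

Lemma check_cmdP s : env s -> sc s ra < n -> sc s rb < sc s ra -> sc s rsg <= 1 ->
  sc s rc < sc s rh ->
  let s' := den check_cmd s in
  (forall p, p < n * n -> hp s' p = hp s p) /\
  (sc s' rfail = 0 <-> sc s rfail = 0 /\ forall i, i < n ->
     sievev N (sc s rh) (sc s rc) (initv (sc s rsg) (sc s ra) (sc s rb)) i = 0%R).
Proof.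
move=> es an bn sg1 ch; rewrite /check_cmd 3!den_seq.
have [h1 Z1 W1 th1 v1] := init_cmdP es an bn sg1.
have e1 : env (den init_cmd s) by exact: env_den.
have f1 x : x \notin writes init_cmd -> sc (den init_cmd s) x = sc s x by apply: sc_den.
move: (den init_cmd s) h1 Z1 W1 th1 v1 e1 f1 => y1 h1 Z1 W1 th1 v1 e1 f1.
rewrite -Z1 in v1.
have [|||h2 v2] := sieve_loopP e1 _ _ th1 _ v1.
- by rewrite Z1.
- by rewrite Z1.
- by rewrite !f1.
rewrite !f1 // in v2.
have e2 : env (den sieve_loop y1) by exact: env_den.
have f2 x : x \notin writes sieve_loop -> sc (den sieve_loop y1) x = sc y1 x by apply: sc_den.
move: (den sieve_loop y1) h2 v2 e2 f2 => y2 h2 v2 e2 f2.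
set y3 := den (CAdd rQ rZ zero) y2.
have Q3 : sc y3 rQ = sc y2 rZ by rewrite /y3 /= (env_zero e2) addn0.
have e3 : env y3.
  by apply: (env_frame e2) => // x x5; case: x x5 => [|[|[|[|[|]]]]].
have v3 := v2; rewrite -Q3 in v3.
have [h4 F4] := nonzero_loopP e3 v3.
move: (den nonzero_loop y3) h4 F4 => y4 h4 F4; split.
  by move=> p pn; rewrite h4 h2 // h1.
have F3 : sc y3 rfail = sc s rfail by rewrite /y3 /= f2 // f1.
by rewrite -F3.
Qed.

Definition passv (h r a b : nat) : Prop :=
  (forall i, i < n -> sievev N h 0 (initv 0 a b) i = 0%R) /\
  (forall i, i < n -> sievev N h r (initv 1 a b) i = 0%R).

Lemma test_cmdP s : env s -> sc s ra < n -> sc s rb < sc s ra ->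
  sc s rr < sc s rh ->
  let s' := den test_cmd s in
  let pass := passv (sc s rh) (sc s rr) (sc s ra) (sc s rb) in
  [/\ forall p, p < n * n -> hp s' p = hp s p,
     pass -> sc s' rres = maxn (sc s rres) (sc s rh) &
     ~ pass -> sc s' rres = sc s rres].
Proof.
move=> es an bn rh; rewrite /test_cmd 5!den_seq.
set y1 := den (_ ;; _) s.
have z0 := env_zero es; have o0 := env_one es.
have e1 : env y1.
  by apply: (env_frame es) => // x x5; case: x x5 => [|[|[|[|[|]]]]].
have sg1 : sc y1 rsg = 0 by rewrite /y1 /= z0.
have c1 : sc y1 rc = 0 by rewrite /y1 /= z0.
have F1 : sc y1 rfail = 0 by rewrite /y1 /= z0.
have [||||h2 F2] := @check_cmdP y1 e1.
- exact: an.
- exact: bn.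
- by rewrite sg1.
- by rewrite c1; apply: leq_ltn_trans rh.
rewrite sg1 c1 F1 in F2.
have e2 : env (den check_cmd y1) by exact: env_den.
have f2 x : x \notin writes check_cmd -> sc (den check_cmd y1) x = sc y1 x by apply: sc_den.
move: (den check_cmd y1) h2 F2 e2 f2 => y2 h2 F2 e2 f2.
set y3 := den (_ ;; _) y2.
have e3 : env y3.
  by apply: (env_frame e2) => // x x5; case: x x5 => [|[|[|[|[|]]]]].
have r2 : sc y2 rr = sc s rr by rewrite f2.
have a3 : sc y3 ra = sc s ra by rewrite /y3 /= f2.
have b3 : sc y3 rb = sc s rb by rewrite /y3 /= f2.
have h3 : sc y3 6 = sc s 6 by rewrite /y3 /= f2.
have sg3 : sc y3 rsg = 1 by rewrite /y3 /= (env_zero e2) (env_one e2).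
have c3 : sc y3 rc = sc s rr by rewrite /y3 /= (env_zero e2) addn0 r2.
have [||||h4 F4] := @check_cmdP y3 e3.
- by rewrite a3.
- by rewrite a3 b3.
- by rewrite sg3.
- by rewrite c3 h3.
rewrite a3 b3 sg3 c3 h3 in F4.
have f4 x : x \notin writes check_cmd -> sc (den check_cmd y3) x = sc y3 x by apply: sc_den.
have res4 : sc (den check_cmd y3) rres = sc s rres by rewrite f4 // /y3 /= f2.
have h4' : sc (den check_cmd y3) 6 = sc s 6 by rewrite f4 // h3.
have o4 : sc (den check_cmd y3) one = 1 by rewrite f4 // (env_one e3).
move: (den check_cmd y3) h4 F4 res4 h4' o4 {f4} => y4 h4 F4 res4 h4' o4.
have E : sc y4 rfail = 0 <-> passv (sc s 6) (sc s rr) (sc s ra) (sc s rb).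
  rewrite F4 [sc y3 rfail]/(sc y2 rfail) F2.
  by split=> [[[_ ?] ?] | [? ?]].
have hps p : p < n * n -> hp y4 p = hp s p by move=> pn; exact: (etrans (h4 p pn) (h2 p pn)).
rewrite /= o4; split.
- by move=> p pn; case: ifP => _ /=; exact: hps.
- move=> /E ->; rewrite /= res4 h4'; lia.
- move=> npass; have f0 : sc y4 rfail != 0 by apply/eqP => /E.
  have -> : (1 - sc y4 rfail == 0) by lia.
  by [].
Qed.

Definition found (h : nat) : Prop := exists r a b,
  [/\ b < a, a < n, 0 < r < h & passv h r a b].

(** The effect of any part of the search on the result, in a form that composes: it never decreases,
    and any new value is witnessed by a passed test. *)
Definition extends s s' : Prop :=
  [/\ forall p, p < n * n -> hp s' p = hp s p, sc s rres <= sc s' rres &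
     sc s' rres = sc s rres \/ found (sc s' rres)].

Lemma extends_trans s1 s2 s3 : extends s1 s2 -> extends s2 s3 -> extends s1 s3.
Proof.
move=> [h1 l1 d1] [h2 l2 d2]; split; first by move=> p pn; rewrite h2 // h1.
  exact: leq_trans l1 l2.
by case: d2 => [->|?]; [|right].
Qed.

(** One rule for the four nested loops. [Q k res] says that round k is accounted for in [res]; being
    monotone in [res], it survives the later rounds. *)
Lemma search_loop (Q : nat -> nat -> Prop) m x c cnt s :
  env s -> sc s x = m ->
  all (fun x => x \notin writes c) (iota 0 5) ->
  (forall k r1 r2, r1 <= r2 -> Q k r1 -> Q k r2) ->
  (forall k y, k < m -> env y -> (forall z, z \notin writes c -> sc y z = sc s z) ->
     sc y cnt = sc s cnt + k ->
     [/\ extends y (den c y), Q k (sc (den c y) rres) &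
        sc (den c y) cnt = (sc y cnt).+1]) ->
  extends s (den (CLoop x c) s) /\
  forall k, k < m -> Q k (sc (den (CLoop x c) s) rres).
Proof.
move=> es sm wc Qmono step.
pose I k y := [/\ extends s y, forall j, j < k -> Q j (sc y rres)
   & sc y cnt = sc s cnt + k].
have [h1 h2 _] : I m (den (CLoop x c) s); last by split.
apply: loop_rule sm _ _ => [|k y km fr [h1 h2 h3]].
  by split=> //; [split=> //; left | rewrite addn0].
have ey : env y.
  apply: (env_frame es) => [z z5|]; last by case: h1.
  by apply: fr; apply: (allP wc); rewrite mem_iota.
have [ext Qk cntS] := step k y km ey fr h3.
split; first exact: extends_trans ext.
- move=> j; rewrite ltnS leq_eqVlt => /orP[/eqP -> //|jk].
  by apply: Qmono (h2 j jk); case: ext.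
- by rewrite cntS h3 addnS.
Qed.

Lemma pair_cmdP s : env s -> sc s ra < n -> 0 < sc s rr < sc s rh ->
  let s' := den pair_cmd s in
  [/\ extends s s',
     sc s rb < sc s ra -> passv (sc s rh) (sc s rr) (sc s ra) (sc s rb) ->
       sc s rh <= sc s' rres &
     sc s' rb = (sc s rb).+1].
Proof.
move=> es an /andP[r0 rlt]; rewrite /pair_cmd 2!den_seq den_if.
set y1 := den (CSub rt ra rb) s.
have e1 : env y1.
  by apply: (env_frame es) => // x x5; case: x x5 => [|[|[|[|[|]]]]].
have -> : sc y1 rt = sc s ra - sc s rb by [].
have [ab|ba] := leqP (sc s ra) (sc s rb).
  have -> : (sc s ra - sc s rb == 0) by lia.
  split; [by split=> //; left | lia | by rewrite /= (env_one es) addn1].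
have -> : (sc s ra - sc s rb == 0) = false by lia.
have [h2 P2 N2] := test_cmdP e1 an ba rlt.
have f2 x : x \notin writes test_cmd -> sc (den test_cmd y1) x = sc y1 x by apply: sc_den.
have b2 : sc (den test_cmd y1) rb = sc s rb by rewrite f2.
have o2 : sc (den test_cmd y1) one = 1 by rewrite f2 // (env_one e1).
move: (den test_cmd y1) h2 P2 N2 b2 o2 {f2} => y2 h2 P2 N2 b2 o2.
have b3 : sc (den (incr rb) y2) rb = (sc s rb).+1 by rewrite /= b2 o2 addn1.
have R3 : sc (den (incr rb) y2) rres = sc y2 rres by [].
have h3 p : p < n * n -> hp (den (incr rb) y2) p = hp s p by exact: h2.
move: (den (incr rb) y2) b3 R3 h3 => y3 b3 R3 h3; rewrite /extends R3.
have [pass|npass] := pselect (passv (sc s rh) (sc s rr) (sc s ra) (sc s rb)).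
  rewrite (P2 pass) [sc y1 rres]/(sc s rres) [sc y1 rh]/(sc s rh).
  split=> // [|_ _]; last exact: leq_maxr.
  split=> //; first exact: leq_maxl.
  have [_|_] := leqP (sc s rh) (sc s rres); first by left.
  by right; exists (sc s rr), (sc s ra), (sc s rb); split=> //; rewrite r0.
by rewrite (N2 npass) [sc y1 rres]/(sc s rres); split=> //; split=> //; left.
Qed.

Lemma b_loopP s : env s -> sc s ra < n -> sc s rb = 0 -> 0 < sc s rr < sc s rh ->
  let s' := den b_loop s in
  extends s s' /\ (forall b, b < sc s ra ->
    passv (sc s rh) (sc s rr) (sc s ra) b -> sc s rh <= sc s' rres).
Proof.
move=> es an b0 rlt.
pose Q k res := k < sc s ra -> passv (sc s rh) (sc s rr) (sc s ra) k -> sc s rh <= res.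
have [||ext all] := @search_loop Q n rn pair_cmd rb s es (env_n es) isT.
- by move=> k r1 r2 r12 Qk ka pk; exact: leq_trans (Qk ka pk) r12.
- move=> k y kn ey fr bE; rewrite b0 add0n in bE.
  have fa : sc y ra = sc s ra by rewrite fr.
  have fr' : sc y rr = sc s rr by rewrite fr.
  have fh : sc y rh = sc s rh by rewrite fr.
  have [||p1 p2 p3] := pair_cmdP ey; first by rewrite fa.
    by rewrite fr' fh.
  by rewrite fa fr' fh bE in p2; split.
by split=> // b ba pb; apply: (all b _ ba pb); exact: ltn_trans ba an.
Qed.

Lemma a_loopP s : env s -> sc s ra = 0 -> 0 < sc s rr < sc s rh ->
  let s' := den a_loop s in
  extends s s' /\ (forall a b, a < n -> b < a ->
    passv (sc s rh) (sc s rr) a b -> sc s rh <= sc s' rres).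
Proof.
move=> es a0 rlt.
pose Q k res := forall b, b < k -> passv (sc s rh) (sc s rr) k b -> sc s rh <= res.
have [||ext all] := @search_loop Q n rn a_body ra s es (env_n es) isT.
- by move=> k r1 r2 r12 Qk b bk pk; exact: leq_trans (Qk b bk pk) r12.
- move=> k y kn ey fr aE; rewrite a0 add0n in aE.
  have fr' : sc y rr = sc s rr by rewrite fr.
  have fh : sc y rh = sc s rh by rewrite fr.
  rewrite /a_body 2!den_seq; set y1 := den (CAdd rb zero zero) y.
  have e1 : env y1.
    by apply: (env_frame ey) => // x x5; case: x x5 => [|[|[|[|[|]]]]].
  have a1 : sc y1 ra = k by [].
  have r1 : sc y1 rr = sc s rr by rewrite -fr'.
  have h1 : sc y1 6 = sc s 6 by rewrite -fh.
  have [|||p1 p2] := b_loopP e1; first by rewrite a1.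
  - by rewrite /y1 /= (env_zero ey).
  - by rewrite r1 h1.
  rewrite a1 r1 h1 in p2.
  have f2 x : x \notin writes b_loop -> sc (den b_loop y1) x = sc y1 x by apply: sc_den.
  have a2 : sc (den b_loop y1) ra = k by rewrite f2.
  have o2 : sc (den b_loop y1) one = 1 by rewrite f2 // (env_one e1).
  move: (den b_loop y1) p1 p2 a2 o2 {f2} => y2 p1 p2 a2 o2.
  by split=> //; rewrite /= a2 o2 addn1 aE.
by split=> // a b an ba pb; exact: (all a an b ba pb).
Qed.

Lemma h_loopP s : env s -> sc s rh = sc s rr -> 0 < sc s rr ->
  let s' := den h_loop s in
  extends s s' /\ (forall d a b, d < N -> a < n -> b < a ->
    passv (sc s rr + d.+1) (sc s rr) a b -> sc s rr + d.+1 <= sc s' rres).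
Proof.
move=> es h0 r0.
pose Q d res := forall a b, a < n -> b < a ->
  passv (sc s rr + d.+1) (sc s rr) a b -> sc s rr + d.+1 <= res.
have [||ext all] := @search_loop Q N rN h_body 6 s es (env_N es) isT.
- by move=> k r1 r2 r12 Qk a b an ba pk; exact: leq_trans (Qk a b an ba pk) r12.
- move=> k y kn ey fr hE; rewrite h0 in hE.
  have fr' : sc y rr = sc s rr by rewrite fr.
  rewrite /h_body den_seq; set y1 := den (_ ;; _) y.
  have e1 : env y1.
    by apply: (env_frame ey) => // x x5; case: x x5 => [|[|[|[|[|]]]]].
  have a1 : sc y1 ra = 0 by rewrite /y1 /= (env_zero ey).
  have r1 : sc y1 rr = sc s rr by rewrite -fr'.
  have h1 : sc y1 6 = sc s rr + k.+1 by rewrite /y1 /= (env_one ey) hE; lia.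
  have [|p1 p2] := a_loopP e1 a1; first by rewrite r1 h1; lia.
  rewrite r1 h1 in p2.
  have f2 x : x \notin writes a_loop -> sc (den a_loop y1) x = sc y1 x by apply: sc_den.
  by split=> //; rewrite f2 // h1 hE addnS.
by split=> // d a b dN an ba pb; exact: (all d dN a b an ba pb).
Qed.

Lemma r_loopP s : env s -> sc s rr = 0 ->
  let s' := den r_loop s in
  extends s s' /\ (forall r d a b, r < N -> d < N -> a < n -> b < a ->
    passv (r.+1 + d.+1) r.+1 a b -> r.+1 + d.+1 <= sc s' rres).
Proof.
move=> es r0.
pose Q r res := forall d a b, d < N -> a < n -> b < a ->
  passv (r.+1 + d.+1) r.+1 a b -> r.+1 + d.+1 <= res.
have [||ext all] := @search_loop Q N rN r_body rr s es (env_N es) isT.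
- by move=> k r1 r2 r12 Qk d a b dN an ba pk; exact: leq_trans (Qk d a b dN an ba pk) r12.
- move=> k y kn ey fr rE; rewrite r0 add0n in rE.
  rewrite /r_body den_seq; set y1 := den (_ ;; _) y.
  have e1 : env y1.
    by apply: (env_frame ey) => // x x5; case: x x5 => [|[|[|[|[|]]]]].
  have r1 : sc y1 rr = k.+1 by rewrite /y1 /= (env_one ey) rE addn1.
  have h1 : sc y1 6 = sc y1 rr by rewrite /y1 /= (env_zero ey) addn0.
  have [|p1 p2] := h_loopP e1 h1; first by rewrite r1.
  rewrite r1 in p2.
  have f2 x : x \notin writes h_loop -> sc (den h_loop y1) x = sc y1 x by apply: sc_den.
  by split=> //; rewrite f2 // r1 rE.
by split=> // r d a b rN dN an ba pb; exact: (all r rN d a b dN an ba pb).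
Qed.

Definition reading (l : seq nat) (m : nat) s : Prop :=
  [/\ sc s rP = m, cinp s = drop m l, cout s = [::] &
     forall p, p < m -> hp s p = nth 0 l p].

Lemma read_loopP l s : sc s rn = n -> sc s one = 1 -> reading l 0 s ->
  reading l (n * n) (den read_loop s).
Proof.
move=> sn s1 rd0.
have := @loop_rule n rn read_row s (fun k => reading l (k * n)) sn.
rewrite mul0n => /(_ rd0); apply=> k y kn fr rdk.
have yn : sc y rn = n by rewrite fr.
have := @loop_rule n rn read_body y (fun j => reading l (k * n + j)) yn.
rewrite addn0 mulSn [n + _]addnC => /(_ rdk); apply=> j z jn frz [h1 h2 h3 h4].
have o1 : sc z one = 1 by rewrite frz // fr.
rewrite /reading /= h1 o1; split=> //.
- by lia.
- by rewrite h2 -drop1 drop_drop add1n addnS.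
- move=> p; rewrite addnS ltnS leq_eqVlt => /orP[/eqP ->|pk].
    by rewrite eqxx h2 -nth0 nth_drop addn0.
  by rewrite ltn_eqF // h4.
Qed.

Lemma answer_cmdP s : sc s one = 1 -> sc s zero = 0 -> sc s rN = N ->
  cout s = [::] ->
  cout (den answer_cmd s) =
    (if sc s rres == 0 then [:: 0]
     else if N < sc s rres then [:: 2] else [:: 1; 1; sc s rres]).
Proof.
move=> o1 z0 eN c0; rewrite /answer_cmd 3!den_seq; set y := den (_ ;; _) s.
have x1 : sc y rx = 1 - sc s rres by rewrite /y /= o1.
have y1 : sc y ry = sc s rres - N by rewrite /y /= eN.
have t1 : sc y rt = 1 - (1 - sc s rres + (sc s rres - N)) by rewrite /y /= o1 eN.
have two : sc y rxj = 2 by rewrite /y /= o1.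
have o : sc y one = 1 by [].
have z : sc y zero = 0 by [].
have cy : cout y = [::] by [].
have <- : sc y rres = sc s rres by [].
move: x1 y1 t1; rewrite -[sc s rres]/(sc y rres).
move: y two o z cy => y two o z cy x1 y1 t1.
rewrite (den_if rx) x1; have [r0|r0] := eqVneq (sc y rres) 0.
  have -> : (1 - sc y rres == 0) = false by lia.
  rewrite /= y1 (_ : sc y rres - N == 0); last by lia.
  rewrite /= t1 (_ : 1 - (1 - sc y rres + (sc y rres - N)) == 0); last by lia.
  by rewrite cy z.
have -> : (1 - sc y rres == 0) by lia.
rewrite (den_if ry) y1; have [big|small] := ltnP N (sc y rres).
  have -> : (sc y rres - N == 0) = false by lia.
  rewrite /= t1 cy two.
  by have -> : (1 - (1 - sc y rres + (sc y rres - N)) == 0) by lia.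
have -> : (sc y rres - N == 0) by lia.
rewrite /= t1 cy o.
by have -> : (1 - (1 - sc y rres + (sc y rres - N)) == 0) = false by lia.
Qed.

End Semantics.

(** * Correctness and running time *)

Section Bridge.
Variables (n : nat) (e : rel 'I_n).

Definition nat_rel (i j : nat) : bool :=
  if (insub i : option 'I_n, insub j : option 'I_n) is (Some x, Some y) then e x y
  else false.

Lemma nat_relE (x y : 'I_n) : nat_rel x y = e x y.
Proof. by rewrite /nat_rel !valK. Qed.

Definition agree (w : nat -> int) (v : 'cV[int]_n) : Prop :=
  forall x : 'I_n, w x = v x 0%R.

Lemma agree_eq0 w v : agree w v ->
  (forall i, i < n -> w i = 0%R) <-> v = 0%R.
Proof.
move=> wv; split=> [w0|v0 i iN].
  by apply/colP => x; rewrite -wv w0 // mxE.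
by have := wv (Ordinal iN); rewrite v0 mxE.
Qed.

Lemma agree_lap_shift th w v : agree w v ->
  agree (lap_shift n nat_rel th w) (intlap e *m v - th%:Z *: v)%R.
Proof.
move=> wv x; rewrite /lap_shift !mxE wv; congr (_ - _)%R.
under eq_bigr do rewrite nat_relE wv mulrBr.
under [RHS]eq_bigr do rewrite mxE mulrBl.
rewrite !sumrB -mulr_suml; congr (_ - _)%R.
rewrite [RHS](bigD1 x) //= eqxx mulr1n [X in _ = (_ + X)%R]big1 ?addr0; last first.
  by move=> y /negbTE yx; rewrite eq_sym yx mulr0n mul0r.
congr (_ * _)%R; rewrite /deg -sum1_card (big_morph Posz PoszD (erefl _)).
rewrite [RHS]big_mkcond /=.
by apply: eq_bigr => y _; rewrite inE; case: (e x y).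
Qed.

Lemma agree_sievev M h c w v : agree w v ->
  agree (sievev n nat_rel M h c w) (sieve e M h c v).
Proof.
rewrite /sievev /sieve; elim: (iota 0 M) w v => //= th s IH w v wv.
apply: IH; rewrite /sieve_stepv /sieve_step; case: ifP => // _.
exact: agree_lap_shift.
Qed.

Lemma passvE h r (a b : 'I_n) :
  passv n nat_rel h r a b <-> passes e (2 * n + 2) h r a b.
Proof.
have agr0 : agree (initv 0 a b) (vsum a b).
  by move=> x; rewrite /initv !mxE !andbT -!val_eqE /= mul1r; do 2! case: eqP.
have agr1 : agree (initv 1 a b) (vdiff a b).
  by move=> x; rewrite /initv !mxE !andbT -!val_eqE /= mulN1r; do 2! case: eqP.
rewrite /passv /passes.
by rewrite (agree_eq0 (agree_sievev _ _ _ agr0)) (agree_eq0 (agree_sievev _ _ _ agr1)).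
Qed.

Lemma nth_allpairs (T1 T2 T3 : Type) (f : T1 -> T2 -> T3) x1 x2 x3 s t i j :
  i < size s -> j < size t ->
  nth x3 [seq f x y | x <- s, y <- t] (i * size t + j) = f (nth x1 s i) (nth x2 t j).
Proof.
elim: s i => // x s IH [|i] /= iN jN.
  by rewrite mul0n add0n nth_cat size_map jN (nth_map x2).
rewrite nth_cat size_map mulSn -addnA ltnNge leq_addr /= addKn.
exact: IH.
Qed.

Local Notation cells :=
  [seq nat_of_bool (e i j) | i <- enum 'I_n, j <- enum 'I_n].

Lemma nth_cells i j : i < n -> j < n -> nth 0 cells (i * n + j) = nat_rel i j.
Proof.
move=> iN jN.
have := @nth_allpairs _ _ _ (fun x y : 'I_n => nat_of_bool (e x y))
  (Ordinal iN) (Ordinal iN) 0 (enum 'I_n) (enum 'I_n) i j.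
rewrite !size_enum_ord => -> //.
by rewrite -nat_relE !nth_enum_ord.
Qed.

Local Notation s0 := (den start_cmd (cinit (graph_input e))).

Lemma revival_cmd_out : symmetric e -> irreflexive e -> exists res,
  search_result e res /\
  cout (den revival_cmd (cinit (graph_input e))) =
    if res == 0 then [:: 0] else if 2 * n + 2 < res then [:: 2] else [:: 1; 1; res].
Proof.
move=> e_sym e_irr; rewrite /revival_cmd den_seq.
have sn : sc s0 0 = n by [].
have sN : sc s0 1 = 2 * n + 2 by rewrite /= ; lia.
have s1 : sc s0 2 = 1 by [].
have sz : sc s0 3 = 0 by [].
have rd0 : reading cells 0 s0 by split=> //=; rewrite drop0.
have sr : sc s0 5 = 0 by [].
have sres : sc s0 12 = 0 by [].
move: s0 sn sN s1 sz rd0 sr sres => s sn sN s1 sz rd0 sr sres.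
rewrite /search_cmd 3!den_seq.
have [P1 I1 O1 H1] := read_loopP sn s1 rd0.
have f1 x : x \notin writes read_loop -> sc (den read_loop s) x = sc s x by apply: sc_den.
move: (den read_loop s) P1 I1 O1 H1 f1 => y1 P1 I1 O1 H1 f1.
set y2 := den _ y1.
have e2 : env n nat_rel y2.
  split; try by rewrite /y2 /= f1.
  - by rewrite /y2 /= P1 f1 // sz addn0.
  - move=> i j iN jN; have ijn : i * n + j < n * n by nia.
    by rewrite -(nth_cells iN jN); exact: H1.
have r2 : sc y2 5 = 0 by rewrite /y2 /= f1.
have res2 : sc y2 12 = 0 by rewrite /y2 /= f1.
have O2 : cout y2 = [::] by [].
have [[h3 _ fnd] max3] := r_loopP e2 r2.
have f3 x : x \notin writes r_loop -> sc (den r_loop y2) x = sc y2 x by apply: sc_den.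
have [_ O3] := @io_den r_loop y2 isT.
move: (den r_loop y2) h3 fnd max3 f3 O3 => y3 h3 fnd max3 f3 O3.
exists (sc y3 12); split; last first.
  by apply: answer_cmdP; rewrite ?f3 ?O3 //; case: e2.
split.
  case: fnd => [->|[r [a [b [ba aN rlt pas]]]]]; [by left | right].
  exists r, (Ordinal aN), (Ordinal (ltn_trans ba aN)); split=> //.
    by rewrite -val_eqE /= gtn_eqF.
  exact/passvE.
(* The ranges of r and d start at 1, whereas the loops count their rounds from 0. *)
move=> [|r] [|d] a b // /andP[_ rN] /andP[_ dN] ba /passvE pas.
exact: max3 pas.
Qed.

Lemma graph_input_short w : 0 < w -> n < 2 ^ w -> short w (graph_input e).
Proof.
move=> w0 nw; rewrite /short /= nw /=; apply/allP => x /allpairsP [p [_ _ ->]].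
by apply: leq_trans (_ : 2 ^ 1 <= _); [case: (e _ _) | rewrite leq_exp2l].
Qed.

(** The four initial steps are split off because they write the loop counts themselves. The factor
    [3 ^ D] comes from 2 n + 3 <= 3 (n + 1). *)
Lemma revival_cmd_time K D : (forall M, time_bound search_cmd M <= K * M.+1 ^ D) ->
  ctime revival_cmd (cinit (graph_input e)) <= (4 + K * 3 ^ D) * n.+1 ^ D.
Proof.
move=> H; have -> : ctime revival_cmd (cinit (graph_input e)) = 4 + ctime search_cmd s0 by [].
have sN : sc s0 1 = 2 * n + 2 by rewrite /=; lia.
have tle : ctime search_cmd s0 <= time_bound search_cmd (2 * n + 2).
  have sn : sc s0 0 = n by [].
  by apply: ctime_le; rewrite ?sN ?sn //; lia.
rewrite mulnDl leq_add ?leq_pmulr ?expn_gt0 //.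
apply: (leq_trans tle); apply: (leq_trans (H _)).
rewrite -mulnA -expnMn leq_mul2l; apply/orP; right.
by case: D {H} => // D; rewrite leq_exp2r //; lia.
Qed.

End Bridge.

Theorem theorem9p1 (R : realType) :
  exists (P : ram_program) (c k : nat),
    forall (n : nat) (e : rel 'I_n),
      symmetric e -> irreflexive e ->
      exists output : seq nat,
        outputs_in_time P (graph_input e) output (c * n.+1 ^ k) /\
        revival_answer R e output.
Proof.
have [w0 timed] := @compiled_outputs revival_cmd isT.
have [K [D search_time]] := time_bound_poly search_cmd.
pose C := 4 + K * 3 ^ D.
(* With T = C (n + 1)^D steps and width w = w0 + 1 + n the cost is at most 5 T (w + T), and w + T is
   at most (w0 + 1 + C) (n + 1)^(D + 1). *)
exists (compile 0 0 revival_cmd), (C * (5 * (w0.+1 + C))), (D + D.+1).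
move=> n e e_sym e_irr.
have [res [res_spec outE]] := revival_cmd_out e_sym e_irr.
exists (cout (den revival_cmd (cinit (graph_input e)))); split; last first.
  by rewrite outE; exact: search_result_answer.
(* A width linear in n is crude but harmless for a polynomial bound; it rests on n < 2 ^ n. *)
have short_input : short (w0.+1 + n) (graph_input e).
  apply: graph_input_short => //; apply: leq_trans (ltn_expl n (isT : 1 < 2)) _.
  by rewrite leq_exp2l // leq_addl.
have [|t [halts outs cost]] := timed _ _ _ _ short_input (revival_cmd_time e search_time).
  by lia.
exists t; split=> //; apply: leq_trans cost _.
rewrite -/C expnD expnS.
have : 0 < n.+1 ^ D by rewrite expn_gt0.
move: (n.+1 ^ D) => E E0.
have bnd : w0.+1 + n + C * E <= (w0.+1 + C) * (n.+1 * E) by nia.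
apply: (@leq_trans (C * E * (5 * ((w0.+1 + C) * (n.+1 * E))))).
  by rewrite leq_mul2l leq_mul2l bnd !orbT.
by rewrite leq_eqVlt; apply/orP; left; apply/eqP; ring.
Qed.
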